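(* Let $\mathcal{K}$ be a complex separable Hilbert space and let $N$ be a model space in $H^2_{\mathcal{K}}$. The following statements are equivalent: (i) The subspace $M=H^2_{\mathcal{K}}\ominus N$ is full range. (ii) The shift compression $A_N$ is strongly stable. (iii) For every orthonormal basis $\{E_j\}_{j\in I}$ of the wandering subspace $M\ominus S(M)$ of $M=H^2_{\mathcal{K}}\ominus N$, the system $\{(S^* )^n(S^*E_j)\}_{j\in I,\,n\geqslant0}$ is a Parseval frame of $N$.
   Context: Let $\mathbb{T}$ be the unit circle with normalized Lebesgue measure. $L^2(\mathbb{T},\mathcal{K})$ is the Hilbert space of square-integrable $\mathcal{K}$-valued functions on $\mathbb{T}$, and $H^2_{\mathcal{K}}\subseteq L^2(\mathbb{T},\mathcal{K})$ is the Hardy space of functions whose Fourier coefficients of negative index vanish. $S:H^2_{\mathcal{K}}\to H^2_{\mathcal{K}}$, $Sf(z)=zf(z)$, is the unilateral shift, with adjoint $S^*f(z)=(f(z)-f(0))/z$, where $f(0)$ is the $0$-th Fourier coefficient of $f$. A model space is a closed $S^*$-invariant subspace $N\subseteq H^2_{\mathcal{K}}$; the shift compression to $N$ is $A_N:N\to N$, $A_Nf=P_NSf$, where $P_N$ is the orthogonal projection onto $N$. For a closed $S$-invariant subspace $M\subseteq H^2_{\mathcal{K}}$, its wandering subspace is $W=M\ominus S(M)$. Given an orthonormal basis $\{E_j\}_{j}$ of $W$, set $J(z)=\overline{\mathrm{span}}\{E_j(z)\}_j\subseteq\mathcal{K}$ for almost every $z\in\mathbb{T}$ (this is independent of the basis,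 up to null sets). $M$ is called full range if $J(z)=\mathcal{K}$ for almost every $z\in\mathbb{T}$. A bounded operator $T$ is strongly stable if $T^nv\to0$ as $n\to+\infty$ for every vector $v$. A countable family $\{x_k\}_k$ in a Hilbert space $N$ is a Parseval frame of $N$ if $\sum_k|\langle x,x_k\rangle|^2=\|x\|^2$ for all $x\in N$. *)

(* Defs.v *)
From HB Require Import structures.
From mathcomp Require Import all_boot all_order all_algebra.
From mathcomp Require Import complex.
From mathcomp Require Import all_classical all_reals all_analysis.
From mathcomp Require Import measurable_realfun.

Set Implicit Arguments.
Unset Strict Implicit.
Unset Printing Implicit Defensive.

Import Order.TTheory GRing.Theory Num.Theory.
Import numFieldNormedType.Exports.

Local Open Scope classical_set_scope.
Local Open Scope ring_scope.

Section circle.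
Variable R : realType.
Local Notation C := R[i].

Definition unit_circle : set C^o := [set z | `|z| = 1].

Lemma expi_subproof (t : R) : ((cos t +i* sin t)%C : C^o) \in unit_circle.
Proof. by rewrite inE /unit_circle /= normc_def /= cos2Dsin2 sqrtr1. Qed.

Definition circle_point : Type := set_type unit_circle.
HB.instance Definition _ := Topological.copy circle_point (set_type unit_circle).

Definition expi0 (t : R) : circle_point :=
  exist (fun z => z \in unit_circle) _ (expi_subproof t).

HB.instance Definition _ := isPointed.Build circle_point (expi0 0).

Definition circle := g_sigma_algebraType (@open circle_point).
HB.instance Definition _ := Measurable.on circle.

Definition expi : measurableTypeR R -> circle := expi0.

Lemma continuous_cossin : continuous (fun t : R => (cos t +i* sin t)%C : C^o).
Proof.
move=> t; apply/cvgrPdist_lt => /= e; rewrite ltcE /= => /andP[/eqP e2 e1].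
have e3 : 0 < complex.Re e / 2 by rewrite divr_gt0.
near=> s.
rewrite normc_def ltcE /= -e2 eqxx /=.
apply: (@le_lt_trans _ _ (`|cos t - cos s| + `|sin t - sin s|)).
  rewrite -[leRHS]ger0_norm ?addr_ge0// -sqrtr_sqr ler_wsqrtr//.
  rewrite [leRHS]sqrrD !real_normK ?num_real// lerD2r lerDl.
  by rewrite mulrn_wge0 ?mulr_ge0.
rewrite [ltRHS]splitr ltrD//.
- by near: s; have /cvgrPdist_lt := @continuous_cos R t; apply.
- by near: s; have /cvgrPdist_lt := @continuous_sin R t; apply.
Unshelve. all: by end_near. Qed.

Lemma continuous_expi0 : continuous expi0.
Proof.
apply: (@continuous_comp_initial _ _ _ _ expi0).
exact: continuous_cossin.
Qed.

Lemma measurable_expi : measurable_fun [set: measurableTypeR R] expi.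
Proof.
apply: (@measurability _ _ (measurableTypeR R) circle setT expi (@open circle_point)) => //.
move=> _ [U oU <-]; rewrite setTI.
apply: open_measurable; apply: open_comp => // t _.
exact: continuous_expi0.
Qed.

HB.instance Definition _ := isMeasurableFun.Build _ _ (measurableTypeR R) circle
  expi measurable_expi.

Lemma twopi_gt0 : 0 < 2 * pi :> R.
Proof. by rewrite mulr_gt0 ?pi_gt0. Qed.

(* Normalized Lebesgue measure on the circle: the law of e^{i t} for t uniform
   in [0, 2 pi]. *)
Definition arc : probability circle R :=
  distribution (uniform_prob twopi_gt0) expi.

End circle.

Definition separable (T : topologicalType) :=
  exists2 D : set T, countable D & dense D.

Definition lspan (k : pzRingType) (V : lmodType k) (A : set V) : set V :=
  [set v | exists (n : nat) (c : 'I_n -> k) (x : 'I_n -> V),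
     (forall i, A (x i)) /\ v = \sum_(i < n) c i *: x i].

Section hardy.
Variables (R : realType) (K : completeNormedModType R[i]).
Variable ip : {dot K for Num.conj}.
Local Notation C := R[i].
Local Notation T := (circle R).
Local Notation mu := (arc R).

(* Norms of K and of C are C-valued in MathComp; rnorm is the real number. *)
Definition rnorm (V : normedModType C) (v : V) : R := complex.Re `|v|.

Definition cintegral (f : T -> C) : C :=
  (Rintegral mu setT (fun z => complex.Re (f z))
   +i* Rintegral mu setT (fun z => complex.Im (f z)))%C.

(* Elements of L^2(T, K) are handled through representatives f : T -> K; two
   representatives are identified when l2norm (f - g) = 0. *)
Definition l2 : set (T -> K) :=
  [set f | measurable_fun setT (f : T -> g_sigma_algebraType (@open K)) /\
           mu.-integrable setT (fun z => (rnorm (f z) ^+ 2)%:E)].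

Definition l2ip (f g : T -> K) : C := cintegral (fun z => ip (f z) (g z)).

Definition l2norm (f : T -> K) : R :=
  Num.sqrt (Rintegral mu setT (fun z => rnorm (f z) ^+ 2)).

Definition l2closure (A : set (T -> K)) : set (T -> K) :=
  [set f | l2 f /\ forall e : R, 0 < e -> exists2 g, A g & l2norm (f - g) < e].

(* The K-valued integral \int z^{-n} f(z), defined weakly. *)
Definition fourier_coef (f : T -> K) (n : int) : K :=
  xget 0 [set c | forall k,
    ip c k = cintegral (fun z => val z ^ (- n) * ip (f z) k)].

Definition hardy : set (T -> K) :=
  [set f | l2 f /\ forall n : int, n < 0 -> fourier_coef f n = 0].

Definition shift (f : T -> K) : T -> K := fun z => val z *: f z.

Definition bshift (f : T -> K) : T -> K :=
  fun z => (val z)^-1 *: (f z - fourier_coef f 0).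

(* A closed subspace is a union of a.e.-equality classes, since l2closure N
   contains every function a.e. equal to an element of N. *)
Definition closed_subspace (N : set (T -> K)) :=
  [/\ N 0,
      forall (a : C) f g, N f -> N g -> N (a *: f + g) &
      l2closure N `<=` N].

Definition model_space (N : set (T -> K)) :=
  [/\ N `<=` hardy, closed_subspace N & forall f, N f -> N (bshift f)].

Definition ominus (A B : set (T -> K)) : set (T -> K) :=
  [set f | A f /\ forall g, B g -> l2ip f g = 0].

(* A representative of the orthogonal projection, unique up to a.e. equality. *)
Definition proj (N : set (T -> K)) (f : T -> K) : T -> K :=
  xget 0 [set g | N g /\ forall h, N h -> l2ip (f - g) h = 0].

Definition compression (N : set (T -> K)) (f : T -> K) : T -> K :=
  proj N (shift f).

Definition strongly_stable (N : set (T -> K)) (A : (T -> K) -> (T -> K)) :=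
  forall f, N f -> (fun n => l2norm (iter n A f)) @ \oo --> (0 : R).

Definition wandering (M : set (T -> K)) : set (T -> K) :=
  ominus M (shift @` M).

Definition orthonormal_basis (I : choiceType) (E : I -> T -> K)
    (W : set (T -> K)) :=
  [/\ range E `<=` W,
      forall i j, l2ip (E i) (E j) = (i == j)%:R &
      W `<=` l2closure (lspan (range E))].

Definition range_space (I : choiceType) (E : I -> T -> K) (z : T) : set K :=
  closure (lspan (range (fun j => E j z))).

(* Up to null sets range_space E does not depend on the orthonormal basis E,
   and one exists by separability; so "for every basis" and "for some basis"
   agree. *)
Definition full_range (M : set (T -> K)) :=
  forall (I : choiceType) (E : I -> T -> K),
    orthonormal_basis E (wandering M) ->
    {ae mu, forall z, range_space E z = setT}.

Definition parseval_frame (J : choiceType) (x : J -> T -> K)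
    (N : set (T -> K)) :=
  [/\ countable [set: J], range x `<=` N &
      forall f, N f ->
        (\esum_(k in [set: J]) (rnorm (l2ip f (x k) : C^o) ^+ 2)%:E
         = (l2norm f ^+ 2)%:E)%E].

End hardy.

(* Main.v *)
Require Import Defs.
From mathcomp Require Import all_boot all_order all_algebra.
From mathcomp Require Import complex.
From mathcomp Require Import all_classical all_reals all_analysis.
From mathcomp Require Import measurable_realfun ring lra zify.

Set Implicit Arguments.
Unset Strict Implicit.
Unset Printing Implicit Defensive.

Import Order.TTheory GRing.Theory Num.Theory.
Import numFieldNormedType.Exports.

Local Open Scope classical_set_scope.
Local Open Scope ring_scope.

(** Let [M] be the orthogonal complement of [N] in the Hardy space, [W] its
    wandering subspace, [(E_j)] an orthonormal basis of [W] and [S] the shift.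
    Everything is read off from the orthonormal family [z^n E_j], where [n] runs
    over all integers ([mode], [mode_orthonormal]).

    By the Wold decomposition ([wold]) the modes with [n >= 0] span [M]. The
    coefficient of [f] in [N] on the frame vector [S^*^(n+1) E_j] is its
    coefficient on [z^-(n+1) E_j] ([frame_coef]), and its coefficients on the
    modes with [n >= 0] vanish. So the frame is Parseval exactly when every
    element of [N] is in the closed span of the modes.

    Stability. As [S M] is contained in [M], [A_N^n f = P_N S^n f], and the norm
    lost is that of [P_M S^n f]. Expanding it on the modes with [n >= 0] gives
    the first [n] layers of frame coefficients of [f] ([compression_loss]). Hence
    [|A_N^n f|^2] decreases to the defect in the Parseval identity
    ([stable_parseval]).

    Full range. If the [E_j(z)] span [K] for almost every [z], a function [f]
    orthogonal to all modes has scalar products [<f(z), E_j(z)>] with no Fourier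
    coefficients, so [f] vanishes ([mode_total]); the modes are then total and
    the Parseval identity holds. Conversely, if the closed span of the modes
    contains [N], it contains [M + N], so every constant is a limit, almost
    everywhere along a subsequence, of combinations of modes, whose values at [z]
    are in the span of the [E_j(z)] ([parseval_full_range]).

    The supporting theory is that of Hilbert spaces, done for semi-inner products
    ([riesz], [projection], [parseval], [orthonormal_basis_exists]), completeness
    of the space of square-integrable [K]-valued functions ([complete_l2]), and
    uniqueness of Fourier coefficients. The last point rests on the fact that a
    closed subspace invariant under multiplication by [z] and its conjugate is
    invariant under restriction to Borel sets ([indicator_multiplier]). *)

(** * Real and complex preliminaries *)

Section complex_parts.
Variable R : realType.
Local Notation C := R[i].
Implicit Types (z w : C) (t : R).

Definition abs2 z : R := complex.Re z ^+ 2 + complex.Im z ^+ 2.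

Lemma cReD z w : @complex.Re R (z + w) = @complex.Re R z + @complex.Re R w.
Proof. by case: z w => [a b] []. Qed.

Lemma cImD z w : @complex.Im R (z + w) = @complex.Im R z + @complex.Im R w.
Proof. by case: z w => [a b] []. Qed.

Lemma cReN z : @complex.Re R (- z) = - @complex.Re R z.
Proof. by case: z. Qed.

Lemma cImN z : @complex.Im R (- z) = - @complex.Im R z.
Proof. by case: z. Qed.

Lemma cReM z w : @complex.Re R (z * w) =
  @complex.Re R z * @complex.Re R w - @complex.Im R z * @complex.Im R w.
Proof. by case: z w => [a b] []. Qed.

Lemma cImM z w : @complex.Im R (z * w) =
  @complex.Re R z * @complex.Im R w + @complex.Im R z * @complex.Re R w.
Proof. by case: z w => [a b] [c d] /=. Qed.

Lemma cReC z : @complex.Re R (z^*) = @complex.Re R z.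
Proof. by case: z. Qed.

Lemma cImC z : @complex.Im R (z^*) = - @complex.Im R z.
Proof. by case: z. Qed.

Definition ReImE := (cReD, cImD, cReN, cImN, cReM, cImM, cReC, cImC).

Lemma complex_ext z w :
  complex.Re z = complex.Re w -> complex.Im z = complex.Im w -> z = w.
Proof. by case: z w => [a b] [c d] /= -> ->. Qed.

Lemma abs2_ge0 z : 0 <= abs2 z.
Proof. by rewrite addr_ge0 // sqr_ge0. Qed.

Lemma abs2_eq0 z : abs2 z = 0 -> z = 0.
Proof.
move=> /eqP; rewrite paddr_eq0 ?sqr_ge0 // !sqrf_eq0 => /andP[/eqP a /eqP b].
exact: complex_ext.
Qed.

Lemma abs2C z : abs2 (z^*) = abs2 z.
Proof. by rewrite /abs2 !ReImE; ring. Qed.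

Lemma mulCconj z : z * z^* = (abs2 z)%:C%C.
Proof. by apply: complex_ext; rewrite ?ReImE /abs2 /=; ring. Qed.

Lemma rnormE2 z : rnorm (z : C^o) ^+ 2 = abs2 z.
Proof. by rewrite /rnorm normc_def /= sqr_sqrtr // abs2_ge0. Qed.

Lemma discr_le0 (a b c : R) : 0 <= a ->
  (forall t, 0 <= t ^+ 2 * a + 2 * t * b + c) -> b ^+ 2 <= a * c.
Proof.
rewrite le_eqVlt => /predU1P[<-|a0] h.
  have [->|b0] := eqVneq b 0; first by rewrite mul0r expr0n.
  have := h (- (c + 1) / (2 * b)).
  rewrite mulr0 add0r (_ : 2 * _ * b = - (c + 1)); last by field.
  by rewrite opprD addrAC addNr add0r oppr_ge0 ler10.
have := h (- b / a).
rewrite (_ : _ + c = (a * c - b ^+ 2) / a); last by field; rewrite gt_eqF.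
by rewrite pmulr_lge0 ?invr_gt0 // subr_ge0.
Qed.

Lemma expr_small (r e : R) : 0 <= r -> r < 1 -> 0 < e ->
  \forall n \near \oo, r ^+ n < e.
Proof.
move=> r0 r1 e0; have : `|r| < 1 by rewrite ger0_norm.
move=> /cvg_expr /cvgrPdist_lt /(_ _ e0); apply: filterS => n.
by rewrite sub0r normrN ger0_norm // exprn_ge0.
Qed.

End complex_parts.

(** * Hilbert space theory for semi-inner products *)

Definition linear_set (k : pzRingType) (V : lmodType k) (A : set V) :=
  A 0 /\ forall (a : k) f g, A f -> A g -> A (a *: f + g).

Section linear_set.
Variables (k : pzRingType) (V : lmodType k).
Implicit Type A : set V.

Lemma linear_setD A f g : linear_set A -> A f -> A g -> A (f + g).
Proof. by move=> [_ L] ? ?; rewrite -[f]scale1r; exact: L. Qed.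

Lemma linear_setZ A a f : linear_set A -> A f -> A (a *: f).
Proof. by move=> [A0 L] ?; rewrite -[a *: f]addr0; exact: L. Qed.

Lemma linear_setN A f : linear_set A -> A f -> A (- f).
Proof. by move=> LA ?; rewrite -scaleN1r; exact: linear_setZ. Qed.

Lemma linear_setB A f g : linear_set A -> A f -> A g -> A (f - g).
Proof. by move=> LA ? ?; apply: linear_setD => //; exact: linear_setN. Qed.

Lemma linear_set_sum A (I : Type) (s : seq I) (x : I -> V) :
  linear_set A -> (forall i, A (x i)) -> A (\sum_(i <- s) x i).
Proof.
move=> LA Ax; elim: s => [|i s ih]; first by rewrite big_nil; case: LA.
by rewrite big_cons; exact: linear_setD.
Qed.

Lemma linear_lspan A : linear_set (lspan A).
Proof.
split; first by exists 0%N, (fun=> 0), (fun=> 0); split=> [[]|] //; rewrite big_ord0.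
move=> a _ _ [n [c [x [Ax ->]]]] [m [d [y [Ay ->]]]].
exists (n + m)%N, (fun i : 'I_(n + m) => match fintype.split i with inl j => a * c j | inr j => d j end),
  (fun i : 'I_(n + m) => match fintype.split i with inl j => x j | inr j => y j end).
split=> [i|]; first by case: (fintype.split i).
rewrite big_split_ord /= scaler_sumr; congr (_ + _); apply: eq_bigr => i _.
  by rewrite (unsplitK (inl i)) scalerA.
by rewrite (unsplitK (inr i)).
Qed.

Lemma sub_lspan A : A `<=` lspan A.
Proof.
move=> f Af; exists 1%N, (fun=> 1), (fun=> f); split=> //.
by rewrite big_ord1 scale1r.
Qed.

Lemma lspan_sub A L : linear_set L -> A `<=` L -> lspan A `<=` L.
Proof.
move=> LL AL _ [n [c [x [Ax ->]]]]; apply: linear_set_sum => // i.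
by apply: linear_setZ => //; exact: AL.
Qed.

End linear_set.

(** Square-integrable functions are manipulated through representatives, so the
    form is only semidefinite, and it is sesquilinear only on the subset [H]
    where the defining integrals converge; hence this relative structure. *)
Record semi_inner (R : realType) (V : lmodType R[i]) (H : set V)
    (B : V -> V -> R[i]) : Prop := SemiInner {
  si_linear : linear_set H ;
  si_lin : forall (a : R[i]) f g h, H f -> H g -> H h ->
    B (a *: f + g) h = a * B f h + B g h ;
  si_conj : forall f g, H f -> H g -> B g f = (B f g)^* ;
  si_ge0 : forall f, H f -> 0 <= complex.Re (B f f) }.

Section semi_inner_def.
Variables (R : realType) (V : lmodType R[i]).
Implicit Types (H A : set V) (B : V -> V -> R[i]).

Definition sqnorm B f : R := complex.Re (B f f).

Definition clos H B A : set V :=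
  [set f | H f /\ forall e, 0 < e -> exists2 g, A g & sqnorm B (f - g) < e].

(** Restricting to sequences with geometrically small steps costs nothing, as
    every Cauchy sequence has such a subsequence, and for functions it gives
    almost everywhere convergence without extraction. *)
Definition complete_for H B := forall u : nat -> V, (forall n, H (u n)) ->
  (forall n, sqnorm B (u n.+1 - u n) <= (4^-1) ^+ n) ->
  exists2 g, H g & forall e, 0 < e -> \forall n \near \oo, sqnorm B (u n - g) < e.

Definition orthonormal_for B (J : choiceType) (u : J -> V) :=
  forall i j, B (u i) (u j) = (i == j)%:R.

End semi_inner_def.

Section semi_inner_theory.
Variables (R : realType) (V : lmodType R[i]) (H : set V) (B : V -> V -> R[i]).
Hypothesis BH : semi_inner H B.
Local Notation C := R[i].
Local Notation sq := (sqnorm B).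
Local Notation clos := (clos H B).
Local Notation rB f g := (complex.Re (B f g)).
Implicit Types (f g h : V) (A N : set V).

Let LH : linear_set H := si_linear BH.
Let HD f g : H f -> H g -> H (f + g) := fun a b => linear_setD LH a b.
Let HZ a f : H f -> H (a *: f) := fun b => linear_setZ a LH b.
Let HN f : H f -> H (- f) := fun b => linear_setN LH b.
Let HB f g : H f -> H g -> H (f - g) := fun a b => linear_setB LH a b.
Let H0 : H 0 := LH.1.
Hint Resolve HD HZ HN HB H0 : core.

Lemma siC f g : H f -> H g -> B g f = (B f g)^*.
Proof. by move=> Hf Hg; exact: (si_conj BH Hf Hg). Qed.

Lemma siDl f g h : H f -> H g -> H h -> B (f + g) h = B f h + B g h.
Proof. by move=> ? ? ?; rewrite -[f]scale1r (si_lin BH) // scale1r mul1r. Qed.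

Lemma si0l h : H h -> B 0 h = 0.
Proof.
by move=> Hh; apply: (addrI (B 0 h)); rewrite -siDl // !addr0.
Qed.

Lemma siZl (a : C) f h : H f -> H h -> B (a *: f) h = a * B f h.
Proof. by move=> ? ?; rewrite -[a *: f]addr0 (si_lin BH) // si0l // addr0. Qed.

Lemma siNl f h : H f -> H h -> B (- f) h = - B f h.
Proof. by move=> ? ?; rewrite -scaleN1r siZl // mulN1r. Qed.

Lemma siBl f g h : H f -> H g -> H h -> B (f - g) h = B f h - B g h.
Proof. by move=> ? ? ?; rewrite siDl ?siNl //; exact: HN. Qed.

Lemma siDr f g h : H f -> H g -> H h -> B h (f + g) = B h f + B h g.
Proof.
move=> Hf Hg Hh; rewrite (siC (HD Hf Hg) Hh) siDl // rmorphD.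
by rewrite (siC Hf Hh) (siC Hg Hh).
Qed.

Lemma siZr (a : C) f h : H f -> H h -> B h (a *: f) = a^* * B h f.
Proof. by move=> Hf Hh; rewrite (siC (HZ a Hf) Hh) siZl // rmorphM (siC Hf Hh). Qed.

Lemma siNr f h : H f -> H h -> B h (- f) = - B h f.
Proof. by move=> ? ?; rewrite -scaleN1r siZr // rmorphN rmorph1 mulN1r. Qed.

Lemma siBr f g h : H f -> H g -> H h -> B h (f - g) = B h f - B h g.
Proof. by move=> ? ? ?; rewrite siDr ?siNr //; exact: HN. Qed.

Lemma si0r h : H h -> B h 0 = 0.
Proof. by move=> Hh; rewrite (siC H0 Hh) si0l // rmorph0. Qed.

Lemma siE f : H f -> B f f = (sq f)%:C%C.
Proof.
move=> Hf; apply: complex_ext => //=.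
by have := congr1 (@complex.Im R) (siC Hf Hf); rewrite cImC; lra.
Qed.

Lemma sq_ge0 f : H f -> 0 <= sq f.
Proof. by move=> Hf; exact: (si_ge0 BH Hf). Qed.
Hint Resolve sq_ge0 : core.

Lemma sqD f g : H f -> H g -> sq (f + g) = sq f + 2 * rB f g + sq g.
Proof.
move=> Hf Hg; rewrite /sq siDl ?siDr //; auto.
by rewrite (siC Hf Hg) !ReImE; ring.
Qed.

Lemma sqN f : H f -> sq (- f) = sq f.
Proof. by move=> ?; rewrite /sq siNl ?siNr ?opprK //; exact: HN. Qed.

Lemma sqB f g : H f -> H g -> sq (f - g) = sq f - 2 * rB f g + sq g.
Proof. by move=> ? ?; rewrite sqD ?sqN ?siNr ?cReN //; [ring|exact: HN]. Qed.

Lemma sqBC f g : H f -> H g -> sq (f - g) = sq (g - f).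
Proof. by move=> ? ?; rewrite -sqN ?opprB //; exact: HB. Qed.

Lemma sqZ (a : C) f : H f -> sq (a *: f) = abs2 a * sq f.
Proof.
move=> ?; rewrite /sq siZl ?siZr //; last by auto.
by rewrite mulrA mulCconj siE // cReM /= mul0r subr0.
Qed.

Lemma reC f g : H f -> H g -> rB g f = rB f g.
Proof. by move=> ? ?; rewrite siC // cReC. Qed.

Lemma rCS f g : H f -> H g -> rB f g ^+ 2 <= sq f * sq g.
Proof.
move=> Hf Hg; apply: discr_le0 => [|t]; first exact: sq_ge0.
have := sq_ge0 (HD (HZ t%:C%C Hf) Hg); rewrite sqD ?sqZ ?siZl ?cReM //=.
  by rewrite /abs2 /= => /le_trans; apply; rewrite le_eqVlt; apply/orP/or_introl/eqP; ring.
exact: HZ.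
Qed.

Lemma abs2_CS f g : H f -> H g -> abs2 (B f g) <= sq f * sq g.
Proof.
move=> Hf Hg; set z := B f g.
have := rCS (HZ z^* Hf) Hg; rewrite siZl // -/z mulrC mulCconj /= sqZ // abs2C.
have [->|z0] := eqVneq (abs2 z) 0; first by rewrite mulr_ge0 ?sq_ge0.
by rewrite expr2 -mulrA ler_pM2l // lt_neqAle eq_sym z0 abs2_ge0.
Qed.

Lemma null_ortho f g : H f -> H g -> sq f = 0 -> B f g = 0.
Proof.
move=> Hf Hg f0; apply: abs2_eq0; apply/eqP; rewrite eq_le abs2_ge0 andbT.
by apply: le_trans (abs2_CS Hf Hg) _; rewrite f0 mul0r.
Qed.

Lemma sq_triangle f g h : H f -> H g -> H h ->
  sq (f - h) <= 2 * sq (f - g) + 2 * sq (g - h).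
Proof.
move=> Hf Hg Hh.
have Hfg := HB Hf Hg; have Hgh := HB Hg Hh.
have := sq_ge0 (HB Hfg Hgh); rewrite (sqB Hfg Hgh).
rewrite (_ : f - h = (f - g) + (g - h)); last by rewrite addrA subrK.
by rewrite (sqD Hfg Hgh); lra.
Qed.

Lemma parallelogram f g : H f -> H g ->
  sq (f - g) = 2 * sq f + 2 * sq g - 4 * sq ((2^-1)%:C%C *: (f + g)).
Proof.
move=> Hf Hg; rewrite sqZ; last by auto.
by rewrite sqB // sqD // /abs2 /=; field.
Qed.

(** Riesz representation by minimising [sq h - 2 Re (phi h)]: the parallelogram
    law makes minimising sequences Cauchy, and the limit is stationary. *)
Lemma riesz (phi : V -> C) (c : R) : complete_for H B ->
  (forall (a : C) f g, H f -> H g -> phi (a *: f + g) = a^* * phi f + phi g) ->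
  (forall f, H f -> complex.Re (phi f) ^+ 2 <= c * sq f) ->
  exists2 g, H g & forall h, H h -> B g h = phi h.
Proof.
move=> cH phiL phiB.
have phi0 : phi 0 = 0.
  apply: (addrI (phi 0)); have := phiL 1 0 0 H0 H0.
  by rewrite scaler0 !addr0 rmorph1 mul1r.
have phiZ (a : C) f : H f -> phi (a *: f) = a^* * phi f.
  by move=> Hf; rewrite -[a *: f]addr0 phiL // phi0 addr0.
have phiD f g : H f -> H g -> phi (f + g) = phi f + phi g.
  by move=> Hf Hg; rewrite -[f]scale1r phiL // rmorph1 mul1r scale1r.
pose J h := sq h - 2 * complex.Re (phi h).
pose E := [set J h | h in H].
have [c' c'0 phiB'] : exists2 c', 0 <= c' &
    forall f, H f -> complex.Re (phi f) ^+ 2 <= c' * sq f.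
  exists `|c| => // f Hf; apply: le_trans (phiB _ Hf) _.
  by rewrite ler_wpM2r ?sq_ge0 // ler_norm.
have Jlb h : H h -> - c' <= J h.
  move=> Hh; have := phiB' h Hh; have := sq_ge0 Hh; rewrite /J.
  set s := sq h; set p := complex.Re _ => s0 ps.
  have : 2 * p <= s + c'; last by lra.
  rewrite leNgt; apply/negP => sp.
  suff : (s + c') ^+ 2 < (2 * p) ^+ 2.
    by have := sqr_ge0 (s - c'); lra.
  by rewrite ltr_pXn2r // nnegrE ?addr_ge0 //; lra.
have hiE : has_inf E.
  split; first by exists (J 0), 0.
  by exists (- c') => _ [h Hh <-]; exact: Jlb.
pose d := inf E.
have dJ h : H h -> d <= J h by move=> Hh; apply: ge_inf; [exact: hiE.2|exists h].
(* With this choice the steps of the minimising sequence are at most [4^-n]. *)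
pose eps n : R := (4^-1) ^+ n / 4.
have eps0 n : 0 < eps n by rewrite divr_gt0 // exprn_gt0 // invr_gt0.
have /choice[u uP] : forall n, exists h, H h /\ J h < d + eps n.
  move=> n; have [_ [h Hh <-] hlt] := inf_adherent (eps0 n) hiE.
  by exists h.
have Hu n : H (u n) by case: (uP n).
have [|g Hg ug] := cH u Hu.
  move=> n; have := dJ ((2^-1)%:C%C *: (u n.+1 + u n)) (HZ _ (HD (Hu _) (Hu _))).
  rewrite parallelogram // /J phiZ ?phiD //; last by auto.
  rewrite cReM cReD cImC /= oppr0 mul0r subr0.
  have [_] := uP n; have [_] := uP n.+1; rewrite /J /eps exprS.
  have : 0 < (4^-1 : R) ^+ n by rewrite exprn_gt0 // invr_gt0.
  by lra.
exists g => //.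
have key h : H h -> rB g h = complex.Re (phi h).
  move=> Hh; apply/eqP; rewrite -subr_eq0 -sqrf_eq0 eq_le sqr_ge0 andbT.
  apply/ler_addgt0Pr => e e0; rewrite add0r.
  pose s := sq h + 1.
  have s0 : 0 < s by rewrite ltr_wpDl ?sq_ge0.
  have e4 : 0 < e / (4 * s) by rewrite divr_gt0 // mulr_gt0.
  have r1 : (4^-1 : R) < 1 by lra.
  have r0 : 0 <= (4^-1 : R) by lra.
  near \oo => n.
  have n1 : sq (u n - g) < e / (4 * s) by near: n; exact: ug.
  have n2 : (4^-1) ^+ n < e / (4 * s) by near: n; exact: expr_small.
  have le1 : (rB (u n) h - complex.Re (phi h)) ^+ 2 <= sq h * eps n.
    apply: discr_le0 => [|t]; first exact: sq_ge0.
    have := dJ (t%:C%C *: h + u n) (HD (HZ _ Hh) (Hu n)); have [_] := uP n.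
    rewrite /J phiL // sqD ?sqZ ?siZl ?ReImE /= //; last by auto.
    by rewrite reC // /abs2 /=; lra.
  have le2 : (rB g h - rB (u n) h) ^+ 2 <= sq (u n - g) * sq h.
    by have := rCS (HB (Hu n) Hg) Hh; rewrite siBl // cReD cReN; lra.
  have e1 : sq h * eps n <= e / 4.
    have : s * (4^-1) ^+ n <= e / 4.
      by rewrite mulrC -ler_pdivlMr // -mulrA -invfM ltW.
    have p1 : 0 <= (4^-1 : R) ^+ n by rewrite exprn_ge0.
    have := sq_ge0 Hh; rewrite /eps /s => q1.
    have := mulr_ge0 q1 p1; nra.
  have e2 : sq (u n - g) * sq h <= e / 4.
    have : sq (u n - g) * s <= e / 4.
      by rewrite -ler_pdivlMr // -mulrA -invfM ltW.
    by rewrite /s mulrDr mulr1; have := sq_ge0 (HB (Hu n) Hg); lra.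
  set x := rB g h in le2 *; set y := rB (u n) h in le1 le2; set z := complex.Re _ in le1 *.
  by have := sqr_ge0 ((x - y) - (y - z)); nra.
move=> h Hh; apply: complex_ext; first exact: key.
have := key ('i%C *: h) (HZ _ Hh); rewrite siZr // phiZ //.
by rewrite !ReImE /=; lra.
Unshelve. all: by end_near. Qed.

End semi_inner_theory.

Section closed_subspaces.
Variables (R : realType) (V : lmodType R[i]) (H : set V) (B : V -> V -> R[i]).
Hypothesis BH : semi_inner H B.
Local Notation C := R[i].
Local Notation sq := (sqnorm B).
Local Notation clos := (clos H B).
Implicit Types (f g h : V) (A N X : set V).

Let LH : linear_set H := si_linear BH.
Let HD f g : H f -> H g -> H (f + g) := fun a b => linear_setD LH a b.
Let HZ a f : H f -> H (a *: f) := fun b => linear_setZ a LH b.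
Let HB f g : H f -> H g -> H (f - g) := fun a b => linear_setB LH a b.
Let H0 : H 0 := LH.1.
Hint Resolve HD HZ HB H0 : core.

Lemma semi_inner_sub N : linear_set N -> N `<=` H -> semi_inner N B.
Proof.
move=> LN NH; split=> //.
- by move=> a f g h /NH ? /NH ? /NH ?; exact: (si_lin BH).
- by move=> f g /NH Hf /NH Hg; exact: (si_conj BH Hf Hg).
- by move=> f /NH Hf; exact: (si_ge0 BH Hf).
Qed.

Lemma sq0 : sq 0 = 0.
Proof. by rewrite /sq (si0l BH). Qed.

Lemma clos_H A : clos A `<=` H.
Proof. by move=> f []. Qed.

Lemma sub_clos A : A `<=` H -> A `<=` clos A.
Proof.
move=> AH f Af; split; first exact: AH.
by move=> e e0; exists f => //; rewrite subrr sq0.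
Qed.

Lemma clos_mono A X : A `<=` X -> clos A `<=` clos X.
Proof.
by move=> AX f [Hf cf]; split=> // e /cf[g Ag fg]; exists g => //; exact: AX.
Qed.

Lemma clos_idem A : A `<=` H -> clos (clos A) `<=` clos A.
Proof.
move=> AH f [Hf cf]; split=> // e e0.
have e4 : 0 < e / 4 by rewrite divr_gt0.
have [g [Hg cg] fg] := cf _ e4; have [h Ah gh] := cg _ e4.
exists h => //; have := sq_triangle BH Hf Hg (AH _ Ah); lra.
Qed.

Lemma linear_clos A : linear_set A -> A `<=` H -> linear_set (clos A).
Proof.
move=> LA AH; split; first exact: sub_clos LA.1.
move=> a f g [Hf cf] [Hg cg]; split=> [|e e0]; first exact: LH.2.
pose c := abs2 a + 1.
have c0 : 0 < c by rewrite ltr_wpDl ?abs2_ge0.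
have e4c : 0 < e / (4 * c) by rewrite divr_gt0 // mulr_gt0.
have e4 : 0 < e / 4 by rewrite divr_gt0.
have [f' Af' ff'] := cf _ e4c; have [g' Ag' gg'] := cg _ e4.
exists (a *: f' + g'); first exact: LA.2.
rewrite (_ : a *: f + g - (a *: f' + g') = a *: (f - f') - (g' - g)); last first.
  by rewrite opprD addrACA scalerBr opprB.
have Hff := HB Hf (AH _ Af'); have Hgg := HB (AH _ Ag') Hg.
have := sq_triangle BH (HZ a Hff) H0 Hgg; rewrite subr0 sub0r (sqN BH) // (sqZ BH) //.
rewrite (sqBC BH) // in gg'; last exact: AH.
have : abs2 a * sq (f - f') <= e / 4.
  have : sq (f - f') * c <= e / 4.
    by rewrite -ler_pdivlMr // -mulrA -invfM ltW.
  by rewrite /c; have := sq_ge0 BH Hff; lra.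
lra.
Qed.

Lemma clos_ortho A f h : A `<=` H -> H h -> clos A f ->
  (forall g, A g -> B g h = 0) -> B f h = 0.
Proof.
move=> AH Hh [Hf cf] Ah; apply: abs2_eq0; apply/eqP.
rewrite eq_le abs2_ge0 andbT; apply/ler_addgt0Pr => e e0; rewrite add0r.
have s0 : 0 < sq h + 1 by rewrite ltr_wpDl ?(sq_ge0 BH).
have [|g Ag fg] := cf (e / (sq h + 1)); first by rewrite divr_gt0.
have Hg := AH _ Ag.
have := abs2_CS BH (HB Hf Hg) Hh; rewrite (siBl BH) // (Ah g) // subr0 => /le_trans; apply.
have : sq (f - g) * (sq h + 1) <= e by rewrite -ler_pdivlMr // ltW.
by rewrite mulrDr mulr1; have := sq_ge0 BH (HB Hf Hg); lra.
Qed.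

Definition perp X : set V := [set f | H f /\ forall h, X h -> B f h = 0].

Lemma linear_perp X : X `<=` H -> linear_set (perp X).
Proof.
move=> XH; split; first by split=> // h /XH Hh; exact: (si0l BH).
move=> a f g [Hf fX] [Hg gX]; split=> [|h Xh]; first exact: LH.2.
by rewrite (si_lin BH) ?fX ?gX ?mulr0 ?addr0 //; exact: XH.
Qed.

Lemma closed_perp X : X `<=` H -> clos (perp X) `<=` perp X.
Proof.
move=> XH f cf; split; first by case: cf.
move=> h Xh; apply: (clos_ortho _ _ cf) => [g []||g []] //; first exact: XH.
by move=> _ /(_ _ Xh).
Qed.

Lemma complete_closed N : complete_for H B -> N `<=` H -> clos N `<=` N ->
  complete_for N B.
Proof.
move=> cH NH cN u Nu Cu; have [|g Hg ug] := cH u _ Cu; first by move=> n; exact: NH.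
exists g => //; apply: cN; split=> // e e0.
have [n _ /(_ n) /= un] := ug _ e0.
exists (u n); first exact: Nu.
by rewrite (sqBC BH) //; [exact: un|exact: NH].
Qed.

(** Projection theorem, as the Riesz representation of [h |-> B f h] on [N]. *)
Lemma projection N f : complete_for H B -> linear_set N -> N `<=` H ->
  clos N `<=` N -> H f ->
  exists2 g, N g & forall h, N h -> B (f - g) h = 0.
Proof.
move=> cH LN NH cN Hf.
have BN := semi_inner_sub LN NH.
have [|h1 h2 h3 N1 N2|h Nh|g Ng gf] := @riesz _ _ _ _ BN (B f) (sq f).
- exact: complete_closed.
- have [? ?] := (NH _ N1, NH _ N2).
  by rewrite (siDr BH) ?(siZr BH) //; auto.
- exact: rCS (NH _ Nh).
- by exists g => // h Nh; rewrite (siBl BH) ?gf ?subrr //; exact: NH.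
Qed.

End closed_subspaces.

Section orthonormal_families.
Variables (R : realType) (V : lmodType R[i]) (H : set V) (B : V -> V -> R[i]).
Hypothesis BH : semi_inner H B.
Variables (J : choiceType) (u : J -> V).
Hypothesis Hu : forall j, H (u j).
Hypothesis ON : orthonormal_for B u.
Local Notation C := R[i].
Local Notation sq := (sqnorm B).
Local Notation clos := (clos H B).
Implicit Types (f g h : V) (s : seq J).

Let LH : linear_set H := si_linear BH.
Let HD f g : H f -> H g -> H (f + g) := fun a b => linear_setD LH a b.
Let HZ a f : H f -> H (a *: f) := fun b => linear_setZ a LH b.
Let HB f g : H f -> H g -> H (f - g) := fun a b => linear_setB LH a b.
Let H0 : H 0 := LH.1.
Hint Resolve HD HZ HB H0 : core.

Lemma sq_orthonormal j : sq (u j) = 1.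
Proof. by rewrite /sq ON eqxx. Qed.

Definition fourier_sum f s := \sum_(j <- s) B f (u j) *: u j.

Lemma H_fourier_sum f s : H (fourier_sum f s).
Proof. by apply: linear_set_sum => // j; auto. Qed.
Hint Resolve H_fourier_sum : core.

Lemma fourier_sum_lspan f s : lspan (range u) (fourier_sum f s).
Proof.
apply: linear_set_sum => [|j]; first exact: linear_lspan.
by apply: linear_setZ; [exact: linear_lspan|apply: sub_lspan; exists j].
Qed.

Lemma lspan_H : lspan (range u) `<=` H.
Proof. by apply: lspan_sub => // _ [j _ <-]. Qed.

Lemma ip_fourier_sum f s k : H f -> uniq s ->
  B (fourier_sum f s) (u k) = (k \in s)%:R * B f (u k).
Proof.
move=> Hf; rewrite /fourier_sum.
elim: s => [_|j s ih /= /andP[js us]]; first by rewrite big_nil (si0l BH) // mul0r.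
rewrite big_cons (siDl BH) ?(siZl BH) // ?ih ?ON //; auto; last exact: H_fourier_sum.
rewrite in_cons [k == j]eq_sym; have [<-|] := eqVneq j k.
  by rewrite (negbTE js) mulr1 mul0r addr0 mul1r.
by rewrite mulr0 add0r.
Qed.

Lemma sq_fourier_rest f s : H f -> uniq s ->
  sq (f - fourier_sum f s) = sq f - \sum_(j <- s) abs2 (B f (u j)).
Proof.
move=> Hf; elim: s => [_|j s ih /= /andP[js us]].
  by rewrite /fourier_sum !big_nil !subr0.
have -> : f - fourier_sum f (j :: s) = f - fourier_sum f s - B f (u j) *: u j.
  by rewrite /fourier_sum big_cons opprD addrA addrAC.
rewrite big_cons (sqB BH) //; auto.
rewrite (siZr BH) ?(siBl BH) // ?ip_fourier_sum // ?(negbTE js) ?mul0r ?subr0 //; auto.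
by rewrite [_^* * _]mulrC mulCconj /= ih // (sqZ BH) // sq_orthonormal; ring.
Qed.

(** Replacing an approximant of [f] by the Fourier sum over the indices that it
    uses can only improve it; the error is then a tail of Bessel's sum. *)
Lemma fourier_sum_best f s g : H f -> uniq s ->
  lspan [set u j | j in [set` s]] g -> sq (f - fourier_sum f s) <= sq (f - g).
Proof.
move=> Hf us sg; set r := f - fourier_sum f s.
have Hr : H r by apply: HB.
have Ls : [set u j | j in [set` s]] `<=` H by move=> _ [j _ <-].
have Hg : H g by apply: lspan_sub sg.
pose N := [set h | H h /\ B h r = 0].
have LN : linear_set N.
  split; first by split=> //; exact: (si0l BH).
  move=> a h k [Hh h0] [Hk k0]; split; first exact: LH.2.
  by rewrite (si_lin BH) // h0 k0 mulr0 addr0.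
have uN j : j \in s -> N (u j).
  move=> js; split=> //; rewrite (siC BH Hr (Hu j)) (siBl BH) //.
  by rewrite ip_fourier_sum // js mul1r subrr rmorph0.
have [_ d0] : N (fourier_sum f s - g).
  apply: linear_setB => //; last first.
    by apply: lspan_sub sg => // _ [j js <-]; exact: uN.
  rewrite /fourier_sum big_seq_cond big_mkcond /=.
  apply: linear_set_sum => // j; case: ifP => [|_]; last exact: LN.1.
  by rewrite andbT => /uN; exact: linear_setZ.
rewrite (_ : f - g = r + (fourier_sum f s - g)); last by rewrite addrA subrK.
have Hd : H (fourier_sum f s - g) by apply: HB.
rewrite (sqD BH) // (siC BH Hd Hr) d0 rmorph0 /= mulr0 addr0 lerDl.
exact: (sq_ge0 BH Hd).
Qed.

Local Notation coef2 f := (fun j => (abs2 (B f (u j)))%:E).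

Lemma bessel_seq f s : H f -> uniq s -> \sum_(j <- s) abs2 (B f (u j)) <= sq f.
Proof.
by move=> Hf us; rewrite -subr_ge0 -sq_fourier_rest // (sq_ge0 BH) //; exact: HB.
Qed.

Lemma bessel f : H f -> (\esum_(j in [set: J]) coef2 f j <= (sq f)%:E)%E.
Proof.
move=> Hf; apply: ub_ereal_sup => _ [F [finF _] <-].
by rewrite fsbig_finite // sumEFin lee_fin bessel_seq.
Qed.

(** The defect in Parseval's identity is the squared distance from [f] to the
    span, as Fourier sums are best approximations. *)
Lemma parseval f : H f ->
  (\esum_(j in [set: J]) coef2 f j)%E = (sq f)%:E <-> clos (lspan (range u)) f.
Proof.
move=> Hf; split=> [sum|[_ cf]].
  split=> // e e0.
  have : ((sq f - e)%:E < \esum_(j in [set: J]) coef2 f j)%E.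
    by rewrite sum lte_fin ltrBlDr ltrDl.
  move=> /ereal_sup_gt[_ [F [finF _] <-]]; rewrite fsbig_finite // sumEFin lte_fin.
  move=> lt; exists (fourier_sum f (finmap.enum_fset (fset_set F))); first exact: fourier_sum_lspan.
  by rewrite sq_fourier_rest //; lra.
apply/eqP; rewrite eq_le bessel //=; apply/lee_addgt0Pr => e e0.
have [g [n [c [x [ux ->]]]] fg] := cf _ e0.
have /choice[j jx] : forall i, exists j, u j = x i by move=> i; have [j _] := ux i; exists j.
pose s := undup (codom j).
have us : uniq s by exact: undup_uniq.
have := @fourier_sum_best f s (\sum_(i < n) c i *: x i) Hf us.
rewrite sq_fourier_rest // => best.
have {}best : sq f - \sum_(k <- s) abs2 (B f (u k)) <= e.
  apply: le_trans (ltW fg); apply: best; exists n, c, x; split=> // i.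
  by exists (j i); rewrite //= mem_undup codom_f.
apply: (@le_trans _ _ ((\sum_(k <- s) abs2 (B f (u k)))%:E + e%:E)%E).
  by rewrite -EFinD lee_fin; lra.
rewrite leeD2r //; apply: esum_ge; exists [set` s] => //.
by rewrite -fsbig_seq // sumEFin.
Qed.

(** By Bessel's inequality only finitely many coefficients exceed a given
    [1/(n+1)]. *)
Lemma countable_coef f : H f -> countable [set j | B f (u j) != 0].
Proof.
move=> Hf.
have -> : [set j | B f (u j) != 0] =
    \bigcup_n [set j | n.+1%:R^-1 < abs2 (B f (u j))].
  apply/seteqP; split=> j /=; last first.
    move=> [n _ /= lt]; apply/eqP => f0; move: lt; rewrite f0 /abs2 /= expr0n addr0.
    by rewrite ltNge invr_ge0 ler0n.
  move=> f0; have : 0 < abs2 (B f (u j)).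
    by rewrite lt_neqAle abs2_ge0 andbT eq_sym; apply: contra f0 => /eqP/abs2_eq0->.
  by move=> /ltr_add_invr[n]; rewrite add0r => lt; exists n.
apply: bigcup_countable => // n _; apply: finite_set_countable.
apply: contrapT => /(@infinite_set_fset _ _ (Num.truncn (n.+1%:R * sq f)).+1)[F FS cF].
have := bessel_seq Hf (finmap.fset_uniq F).
rewrite leNgt => /negP; apply.
have : sq f < n.+1%:R^-1 * (size (finmap.enum_fset F))%:R.
  rewrite mulrC ltr_pdivlMr // mulrC; apply: lt_le_trans (_ : _ < (Num.truncn (n.+1%:R * sq f)).+1%:R) _.
    exact: Num.Theory.truncnS_gt.
  by rewrite ler_nat.
move=> /lt_le_trans; apply.
rewrite -sum1_size natr_sum mulr_sumr big_seq [leRHS]big_seq.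
by apply: ler_sum => j /FS /= /ltW; rewrite mulr1.
Qed.

(** Each [u j] has a nonzero inner product with some vector of the total family,
    and each of these vectors accounts for countably many [j]. *)
Lemma countable_orthonormal (q : nat -> V) : (forall n, H (q n)) ->
  (forall f, H f -> (forall n, B f (q n) = 0) -> sq f = 0) -> countable [set: J].
Proof.
move=> Hq total.
suff -> : [set: J] = \bigcup_n [set j | B (q n) (u j) != 0].
  by apply: bigcup_countable => // n _; exact: countable_coef.
apply/seteqP; split=> // j _; apply: contrapT => nj.
suff : sq (u j) = 0 by rewrite sq_orthonormal => /eqP; rewrite oner_eq0.
apply: total => // n; rewrite (siC BH) //.
have [->|qn0] := eqVneq (B (q n) (u j)) 0; first by rewrite rmorph0.
by case: nj; exists n.
Qed.

(** The residual of the projection of [f] onto the closed span is orthogonal to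
    every [u j], hence null. *)
Lemma total_clos M : complete_for H B -> linear_set M -> M `<=` H ->
  clos M `<=` M -> (forall j, M (u j)) ->
  (forall f, M f -> (forall j, B f (u j) = 0) -> sq f = 0) ->
  M `<=` clos (lspan (range u)).
Proof.
move=> cH LM MH cM uM total f Mf; have Hf := MH _ Mf.
have uL : lspan (range u) `<=` M by apply: lspan_sub => // _ [j _ <-].
set N := clos (lspan (range u)).
have NM : N `<=` M by move=> g /(clos_mono uL)/cM.
have LN : linear_set N by apply: linear_clos lspan_H => //; exact: linear_lspan.
have [|g Ng fg] := @projection _ _ _ _ BH N f cH LN (@clos_H _ _ _ _ _) _ Hf.
  by apply: clos_idem => //; exact: lspan_H.
have Hg : H g by case: Ng.
have fg0 : sq (f - g) = 0.
  apply: total => [|j]; first by apply: linear_setB => //; exact: NM.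
  apply: fg; apply: (sub_clos BH lspan_H).
  by apply: sub_lspan; exists j.
apply: (clos_idem BH lspan_H); split=> // e e0; exists g => //.
by rewrite fg0.
Qed.

End orthonormal_families.

(** Zorn's lemma gives a maximal orthonormal subset, and the projection onto the
    closure of its span misses nothing. *)
Lemma orthonormal_basis_exists (R : realType) (V : lmodType R[i]) (H : set V)
    (B : V -> V -> R[i]) (W : set V) : semi_inner H B -> complete_for H B ->
  linear_set W -> W `<=` H -> clos H B W `<=` W ->
  exists (I : choiceType) (E : I -> V),
    [/\ range E `<=` W, orthonormal_for B E & W `<=` clos H B (lspan (range E))].
Proof.
move=> BH cH LW WH cW.
pose P (S : set V) := S `<=` W /\ forall x y, S x -> S y -> B x y = (x == y)%:R.
have [|S [[SW SON] Smax]] := @Zorn_bigcup _ P.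
  move=> F FP tot; split=> [x [X FX Xx]|x y [X FX Xx] [Y FY Yy]].
    by have [XW _] := FP _ FX; exact: XW.
  have [XY|YX] := tot _ _ FX FY.
    by have [_ ON] := FP _ FY; apply: ON => //; exact: XY.
  by have [_ ON] := FP _ FX; apply: ON => //; exact: YX.
pose E (i : S) : V := val i.
have SE i : S (E i) by apply: set_mem; exact: valP.
have EW i : W (E i) by exact: SW.
have EON : orthonormal_for B E by move=> i j; rewrite SON.
exists S, E; split=> // [_ [i _ <-]//|].
apply: (total_clos BH (u := E)) => // [i|f Wf fE]; first exact: WH.
apply: contrapT => f0; have Hf := WH _ Wf.
(* A nonzero residual [f], once normalised, could be added to [S]. *)
pose e := (Num.sqrt (sqnorm B f))^-1%:C%C *: f.
have sf0 : 0 < sqnorm B f by rewrite lt_neqAle (sq_ge0 BH) // andbT eq_sym; apply/eqP.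
have We : W e by exact: linear_setZ.
have ee : B e e = 1.
  rewrite (siE BH); last exact: WH.
  rewrite (sqZ BH) // /abs2 /= expr0n addr0 exprVn sqr_sqrtr ?ltW // mulVf ?gt_eqF //.
have eS x : S x -> B e x = 0.
  move=> Sx; have Hx := WH _ (SW _ Sx).
  rewrite (siZl BH) // (fE (SigSub (mem_set Sx))) ?mulr0 //.
have He := WH _ We.
apply: (Smax (S `|` [set e])).
  split; first by move=> x Sx; left.
  move=> SS; have Se : S e by apply: SS; right.
  by have := eS _ Se; rewrite ee => /eqP; rewrite oner_eq0.
split=> [x [/SW//|->//]|x y [Sx|->] [Sy|->]].
- exact: SON.
- have Hx := WH _ (SW _ Sx).
  rewrite (siC BH He Hx) eS // rmorph0; case: eqVneq => // xe.
  by have := eS _ Sx; rewrite xe ee => /eqP; rewrite oner_eq0.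
- rewrite eS //; case: eqVneq => // xe.
  by have := eS _ Sy; rewrite -xe ee => /eqP; rewrite oner_eq0.
- by rewrite ee eqxx.
Qed.

(** * The coefficient space: norms, separability and measurability *)

Section coefficient_space.
Variables (R : realType) (K : completeNormedModType R[i]).
Local Notation C := R[i].
Implicit Types x y : K.

Lemma rnormE x : `|x| = (rnorm x)%:C%C.
Proof.
rewrite /rnorm; have := normr_ge0 x; rewrite lecE /= => /andP[/eqP e _].
exact: complex_ext.
Qed.

Lemma rnorm_ge0 x : 0 <= rnorm x.
Proof. by have := normr_ge0 x; rewrite rnormE lecR. Qed.

Lemma rnormD x y : rnorm (x + y) <= rnorm x + rnorm y.
Proof. by have := ler_normD x y; rewrite !rnormE -rmorphD lecR. Qed.

Lemma rnormN x : rnorm (- x) = rnorm x.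
Proof. by rewrite /rnorm normrN. Qed.

Lemma rnormB x y : rnorm (x - y) = rnorm (y - x).
Proof. by rewrite -rnormN opprB. Qed.

Lemma rnorm0 : rnorm (0 : K) = 0.
Proof. by rewrite /rnorm normr0. Qed.

Lemma rnorm_eq0 x : rnorm x = 0 -> x = 0.
Proof. by move=> x0; apply/eqP; rewrite -normr_eq0 rnormE x0. Qed.

Lemma rnorm_triangle y x z : rnorm (x - z) <= rnorm (x - y) + rnorm (y - z).
Proof. by rewrite (_ : x - z = x - y + (y - z)) ?rnormD // addrA subrK. Qed.

(** The norm of [K] takes values in [C], so that neighbourhoods are measured by
    complex radii; only their real parts matter. *)
Lemma Re_pos (e : C) : 0 < e -> 0 < complex.Re e /\ e = (complex.Re e)%:C%C.
Proof.
rewrite ltcE /= => /andP[/eqP e0 ?]; split=> //; exact: complex_ext.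
Qed.

Lemma rnorm_cvgP (F : set_system K) {FF : Filter F} (l : K) :
  F --> l <-> forall e : R, 0 < e -> \forall x \near F, rnorm (l - x) < e.
Proof.
split=> [/cvgrPdist_lt Fl e e0|Fl].
  have /Fl : 0 < e%:C%C by rewrite ltcR.
  by apply: filterS => x; rewrite rnormE ltcR.
apply/cvgrPdist_lt => e /Re_pos[e0 ->]; apply: filterS (Fl _ e0) => x.
by rewrite rnormE ltcR.
Qed.

Lemma nbhs_rnormP (x : K) (A : set K) :
  nbhs x A <-> exists2 e : R, 0 < e & forall y, rnorm (x - y) < e -> A y.
Proof.
split=> [/nbhs_ballP[e /= /Re_pos[e0 ->] xA]|[e e0 xA]].
  exists (complex.Re e) => // y xy; apply: xA.
  by rewrite -ball_normE /ball_ /= rnormE ltcR.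
apply/nbhs_ballP; exists e%:C%C; first by rewrite /= ltcR.
by move=> y; rewrite -ball_normE /ball_ /= rnormE ltcR; exact: xA.
Qed.

Lemma closure_rnormP (A : set K) x :
  closure A x <-> forall e : R, 0 < e -> exists2 y, A y & rnorm (x - y) < e.
Proof.
split=> [clA e e0|clA U /nbhs_rnormP[e e0 xU]].
  have [|y [Ay xy]] := clA [set y | rnorm (x - y) < e].
    by apply/nbhs_rnormP; exists e.
  by exists y.
by have [y Ay xy] := clA e e0; exists y; split=> //; exact: xU.
Qed.

(** Telescoping bounds the distance between two terms by a tail of the series. *)
Lemma cvg_summable_steps (u : nat -> K) (w : nat -> R) :
  (forall n, rnorm (u n.+1 - u n) <= w n) -> cvgn (series w) -> cvgn u.
Proof.
move=> uw cw; apply/cauchy_cvgP/cauchyP => e /Re_pos[e0 ->].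
have w0 n : 0 <= w n by exact: le_trans (rnorm_ge0 _) (uw n).
have [n _ Hn] := (cvgrPdist_lt _ _).1 cw _ e0.
exists (u n); exists n => // m /= nm; rewrite -ball_normE /ball_ /= rnormE ltcR.
have tele : rnorm (u n - u m) <= series w m - series w n.
  rewrite sub_series_geq // rnormB -(subnKC nm); elim: (m - n)%N => [|k ih].
    by rewrite addn0 subrr rnorm0 big_geq.
  rewrite addnS big_nat_recr /= ?leq_addr //.
  apply: le_trans (rnorm_triangle (u (n + k)%N) _ _) _.
  by rewrite addrC lerD.
apply: le_lt_trans tele _.
have nd := @nondecreasing_series R w xpredT 0%N (fun n _ _ => w0 n).
have := nondecreasing_cvgn_le nd cw m; have := Hn n (leqnn n) => /=.
by move=> /(le_lt_trans (ler_norm _)); rewrite /series /=; lra.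
Qed.

End coefficient_space.

Section inner_product.
Variables (R : realType) (K : completeNormedModType R[i]).
Variable ip : {dot K for Num.conj}.
Hypothesis ip_norm : forall x : K, ip x x = `|x| ^+ 2.
Local Notation C := R[i].
Implicit Types x y : K.

Lemma sq_ip x : sqnorm ip x = rnorm x ^+ 2.
Proof. by rewrite /sqnorm ip_norm rnormE -rmorphXn. Qed.

Lemma semi_inner_ip : semi_inner [set: K] ip.
Proof.
split=> //.
- by move=> a f g h _ _ _; rewrite linearPl.
- by move=> f g _ _; rewrite hermC expr0 mul1r.
- by move=> f _; rewrite -/(sqnorm ip f) sq_ip sqr_ge0.
Qed.

Lemma complete_ip : complete_for [set: K] ip.
Proof.
move=> u _ Cu.
have : cvgn u.
  apply: (@cvg_summable_steps _ _ u (fun n => 2^-1 ^+ n)) => [n|].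
    rewrite -(@ler_pXn2r _ 2) ?nnegrE ?rnorm_ge0 ?exprn_ge0 ?invr_ge0 //.
    rewrite -sq_ip exprAC; apply: le_trans (Cu n) _.
    by rewrite lerXn2r ?nnegrE ?exprn_ge0 ?invr_ge0 // expr2; lra.
  have : `|2^-1 : R| < 1 by rewrite ger0_norm ?invr_ge0 // invf_lt1 // ltr1n.
  move=> /(@is_cvg_geometric_series _ 1); rewrite (_ : geometric _ _ = GRing.exp 2^-1) //.
  by apply/funext => n; rewrite /geometric /= mul1r.
move=> cu; have [g ug] := (cvg_ex _).1 cu; exists g => // e e0.
have s0 : 0 < Num.sqrt e by rewrite sqrtr_gt0.
have : \forall n \near \oo, rnorm (g - u n) < Num.sqrt e.
  exact: ((rnorm_cvgP (F := u @ \oo) g).1 ug _ s0).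
apply: filterS => n; rewrite rnormB sq_ip => h.
by rewrite -[ltRHS](@sqr_sqrtr _ e) ?ltW // ltrXn2r // rnorm_ge0.
Qed.

Lemma ip_CS x y : `|complex.Re (ip x y)| <= rnorm x * rnorm y.
Proof.
rewrite -(@ler_pXn2r _ 2) ?nnegrE ?mulr_ge0 ?rnorm_ge0 // exprMn -!sq_ip.
rewrite -normrX ger0_norm ?sqr_ge0 //.
exact: (rCS semi_inner_ip).
Qed.

Lemma Im_ip x y : complex.Im (ip x y) = complex.Re (ip x ('i%C *: y)).
Proof. by rewrite (siZr semi_inner_ip) // !ReImE /=; lra. Qed.

Lemma ip_ext x y : (forall k, ip x k = ip y k) -> x = y.
Proof.
move=> xy; apply/eqP; rewrite -subr_eq0; apply/eqP/rnorm_eq0/eqP.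
rewrite -sqrf_eq0 -sq_ip /sqnorm (siBl semi_inner_ip) // xy subrr.
by rewrite /=.
Qed.

Section measurability.
Hypothesis K_separable : separable K.

Lemma dense_seq : exists d : nat -> K,
  forall x (e : R), 0 < e -> exists n, rnorm (x - d n) < e.
Proof.
have [D cD dD] := K_separable.
have [d Dd] : exists d : nat -> K, D `<=` range d.
  have /pcard_surjP[d ds] := cD.
  by exists d => x /ds.
exists d => x e e0.
have oO : open (interior [set y | rnorm (x - y) < e]) by exact: open_interior.
have [|y [Oy /Dd[n _ dy]]] := dD _ _ oO.
  by exists x; apply/nbhs_rnormP; exists e.
by exists n; rewrite dy; exact: interior_subset Oy.
Qed.

Section on_a_measurable_space.
Variables (d : measure_display) (T : measurableType d).
Local Notation borel f := (measurable_fun setT (f : T -> g_sigma_algebraType (@open K))).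
Implicit Types f g : T -> K.

Lemma borel_continuous f (g : K -> R) : borel f -> continuous g ->
  measurable_fun setT (g \o f).
Proof.
move=> mf cg.
apply: (measurability _ (@RGenOpens.measurableE R)) => _ [_ [a [b ->]] <-].
rewrite comp_preimage.
have := mf measurableT (g @^-1` `]a, b[); rewrite !setTI; apply.
apply: sub_sigma_algebra; move/continuousP : cg; apply.
exact: interval_open.
Qed.

Lemma rnorm_continuous : continuous (@rnorm R K).
Proof.
move=> x; apply/cvgrPdist_lt => e e0; apply/nbhs_rnormP; exists e => // y.
apply: le_lt_trans; rewrite ler_norml.
have := rnormD (x - y) y; have := rnormD (y - x) x.
by rewrite !subrK (rnormB y x); lra.
Qed.

Lemma ip_continuous k : continuous (fun x => complex.Re (ip x k)).
Proof.
move=> x; apply/cvgrPdist_lt => e e0; apply/nbhs_rnormP.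
have c0 : 0 < rnorm k + 1 by rewrite ltr_wpDl ?rnorm_ge0.
exists (e / (rnorm k + 1)); first by rewrite divr_gt0.
move=> y xy; rewrite -cReN -cReD -(siBl semi_inner_ip) //.
apply: le_lt_trans (ip_CS _ _) _; move: xy; rewrite ltr_pdivlMr //.
by apply: le_lt_trans; rewrite ler_wpM2l ?rnorm_ge0 // lerDl.
Qed.

Lemma borel_rnorm f : borel f -> measurable_fun setT (fun z => rnorm (f z)).
Proof. by move=> mf; apply: borel_continuous mf rnorm_continuous. Qed.

Lemma borel_ip f k : borel f -> measurable_fun setT (fun z => complex.Re (ip (f z) k)).
Proof. by move=> mf; apply: (borel_continuous mf (@ip_continuous k)). Qed.

(** Pettis: weak measurability suffices. Closed balls are countable
    intersections of half-spaces because the squared norm is the supremum of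
    [2 Re <x, k> - |k|^2] over a dense set of [k], and every open set is a
    countable union of closed balls. *)
Lemma pettis f : (forall k, measurable_fun setT (fun z => complex.Re (ip (f z) k))) ->
  borel f.
Proof.
move=> wf; have [q qP] := dense_seq.
have mball n (r : R) : 0 <= r -> measurable [set z | rnorm (f z - q n) <= r].
  move=> r0.
  have -> : [set z | rnorm (f z - q n) <= r] = \bigcap_m
      [set z | 2 * complex.Re (ip (f z - q n) (q m)) - rnorm (q m) ^+ 2 <= r ^+ 2].
    apply/seteqP; split=> z /=.
      rewrite -(@ler_pXn2r _ 2) ?nnegrE ?rnorm_ge0 // => h m _ /=.
      have := sq_ge0 semi_inner_ip (I : [set: K] (f z - q n - q m)).
      by rewrite (sqB semi_inner_ip) // !sq_ip; lra.
    move=> h; rewrite -(@ler_pXn2r _ 2) ?nnegrE ?rnorm_ge0 //.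
    apply/ler_addgt0Pr => e e0; have e1 : 0 < Num.sqrt e by rewrite sqrtr_gt0.
    have [m zm] := qP (f z - q n) _ e1.
    have {zm} : rnorm (f z - q n - q m) ^+ 2 < e.
      by rewrite -[ltRHS](@sqr_sqrtr _ e) ?ltW // ltrXn2r // rnorm_ge0.
    rewrite -(sq_ip (_ - q m)) (sqB semi_inner_ip) // !sq_ip.
    by move: (h m I) => /=; lra.
  apply: bigcapT_measurable => m.
  rewrite -[X in measurable X]setTI; apply: measurable_fun_ler => //.
  rewrite [X in measurable_fun _ X](_ : _ = (fun z => complex.Re (ip (f z) (q m)) * 2
     - (2 * complex.Re (ip (q n) (q m)) + rnorm (q m) ^+ 2))); last first.
    by apply/funext => z; rewrite (siBl semi_inner_ip) // !ReImE; ring.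
  by apply: measurable_funB => //; apply: measurable_funM.
apply: (@measurability _ _ T (g_sigma_algebraType (@open K)) setT f (@open K)) => //.
move=> _ [U oU <-]; rewrite setTI.
have -> : f @^-1` U = \bigcup_n \bigcup_(m in
    [set m | forall y, rnorm (y - q n) <= m.+1%:R^-1 -> U y])
    [set z | rnorm (f z - q n) <= m.+1%:R^-1].
  apply/seteqP; split=> [z /= Uz|z [n _ [m /= qU /qU//]]].
  have /nbhs_rnormP[e e0 zU] := open_nbhs_nbhs (conj oU Uz).
  have [m] : exists m, m.+1%:R^-1 < e / 2.
    have /ltr_add_invr[m] : 0 < e / 2 by rewrite divr_gt0.
    by rewrite add0r; exists m.
  move=> me; have m0 : 0 < m.+1%:R^-1 :> R by rewrite invr_gt0.
  have [n zn] := qP (f z) _ m0; exists n => //; exists m => /=; last exact: ltW.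
  move=> y yn; apply: zU; apply: le_lt_trans (rnorm_triangle (q n) _ _) _.
  by rewrite (rnormB _ y); move: (m.+1%:R^-1 : R) me zn yn => r; lra.
apply: bigcupT_measurable => n; apply: bigcup_measurable => m _.
by apply: mball; rewrite invr_ge0.
Qed.

Lemma borel_lin (a : T -> C) f g : borel f -> borel g ->
  measurable_fun setT (fun z => complex.Re (a z)) ->
  measurable_fun setT (fun z => complex.Im (a z)) ->
  borel (fun z => a z *: f z + g z).
Proof.
move=> mf mg ma1 ma2; apply: pettis => k.
rewrite (_ : (fun z => _) = (fun z => complex.Re (a z) * complex.Re (ip (f z) k)
   - complex.Im (a z) * complex.Re (ip (f z) ('i%C *: k)) + complex.Re (ip (g z) k))).
  apply: measurable_funD; last exact: borel_ip.
  by apply: measurable_funB; apply: measurable_funM => //; exact: borel_ip.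
by apply/funext => z; rewrite (si_lin semi_inner_ip) // cReD cReM Im_ip.
Qed.

Lemma borel_cvg (f_ : nat -> T -> K) f : (forall n, borel (f_ n)) ->
  (forall z, f_ ^~ z @ \oo --> f z) -> borel f.
Proof.
move=> mf ff; apply: pettis => k.
apply: (@measurable_fun_cvg _ _ _ setT (fun n z => complex.Re (ip (f_ n z) k))).
  by move=> n; exact: borel_ip.
by move=> z _; apply: (continuous_cvg _ (@ip_continuous k (f z))); exact: ff.
Qed.

Lemma borel_ip2 f g : borel f -> borel g ->
  measurable_fun setT (fun z => complex.Re (ip (f z) (g z))).
Proof.
move=> mf mg.
have mfg : borel (fun z => f z + g z).
  have -> : (fun z => f z + g z) = (fun z => (1 : C) *: f z + g z).
    by apply/funext => z; rewrite scale1r.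
  by apply: (@borel_lin (fun=> 1)) => //; exact: measurable_cst.
rewrite (_ : (fun z => _) = (fun z => (rnorm (f z + g z) ^+ 2 -
    (rnorm (f z) ^+ 2 + rnorm (g z) ^+ 2)) * 2^-1)).
  apply: measurable_funM => //.
  have sqm h : borel h -> measurable_fun setT (fun z => rnorm (h z) ^+ 2).
    by move=> mh; apply: measurable_funX; exact: borel_rnorm.
  by apply: measurable_funB; [|apply: measurable_funD]; exact: sqm.
by apply/funext => z; rewrite -!sq_ip (sqD semi_inner_ip) //; field.
Qed.

End on_a_measurable_space.
End measurability.
End inner_product.

(** * The space of square-integrable functions *)

Lemma ae_imply (d : measure_display) (T : measurableType d) (R : realType)
    (mu : {measure set T -> \bar R}) (P Q : T -> Prop) :
  (forall z, P z -> Q z) -> {ae mu, forall z, P z} -> {ae mu, forall z, Q z}.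
Proof. by move=> PQ; apply: filterS. Qed.

Section finite_measure.
Variables (d : measure_display) (T : measurableType d) (R : realType).
Variable mu : probability T R.
Implicit Types f g : T -> R.
Local Notation intg f := (mu.-integrable setT (EFin \o f)).
Local Notation I f := (Rintegral mu setT f).

Lemma integrable_le f g : measurable_fun setT f -> (forall z, `|f z| <= g z) ->
  intg g -> intg f.
Proof.
move=> mf fg; apply: le_integrable => //; first exact/measurable_EFinP.
by move=> z _ /=; rewrite lee_fin; apply: le_trans (fg z) (ler_norm _).
Qed.

Lemma integrable_lin (a b : R) f g : intg f -> intg g ->
  intg (fun z => a * f z + b * g z).
Proof.
move=> If Ig.
rewrite (_ : EFin \o _ = (fun z => a%:E * (f z)%:E) \+ (fun z => b%:E * (g z)%:E))%E //.
by apply: integrableD => //; exact: integrableZl.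
Qed.

Lemma Rintegral_lin (a b : R) f g : intg f -> intg g ->
  I (fun z => a * f z + b * g z) = a * I f + b * I g.
Proof.
move=> If Ig; have Z (c : R) h : intg h -> intg (fun z => c * h z).
  move=> Ih; rewrite (_ : EFin \o _ = (fun z => c%:E * (h z)%:E))%E //.
  exact: integrableZl.
by rewrite RintegralD ?RintegralZl //; exact: Z.
Qed.

(** A geometric bound on second moments makes the series converge almost
    everywhere: by AM-GM the integral of each term is geometrically small. *)
Lemma ae_cvg_series (w : nat -> T -> R) :
  (forall n, measurable_fun setT (w n)) -> (forall n z, 0 <= w n z) ->
  (forall n, intg (fun z => w n z ^+ 2)) ->
  (forall n, I (fun z => w n z ^+ 2) <= (4^-1) ^+ n) ->
  {ae mu, forall z, cvgn (series (w ^~ z))}.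
Proof.
move=> mw w0 iw Iw.
have Iwn n : (\int[mu]_z (w n z)%:E <= (2 / (2 ^ n)%:R)%:E)%E.
  (* [w <= t + w^2 / t] for this [t]. *)
  pose t : R := 2^-1 ^+ n.
  have t0 : 0 < t by rewrite exprn_gt0 // invr_gt0.
  have ig : intg (fun z => t * cst 1 z + t^-1 * w n z ^+ 2).
    by apply: integrable_lin => //; exact: finite_measure_integrable_cst.
  have wg z : w n z <= t * cst 1 z + t^-1 * w n z ^+ 2.
    rewrite mulr1 -subr_ge0 (_ : _ - _ = t^-1 * ((w n z - t / 2) ^+ 2 + 3 / 4 * t ^+ 2)).
      apply: mulr_ge0; first by rewrite invr_ge0 ltW.
      by rewrite addr_ge0 ?sqr_ge0 // mulr_ge0 ?sqr_ge0 // divr_ge0.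
    by field; rewrite gt_eqF.
  apply: (@le_trans _ _ (\int[mu]_z (t * cst 1 z + t^-1 * w n z ^+ 2)%:E)%E).
    apply: ge0_le_integral => //.
    - by move=> z _; rewrite lee_fin.
    - exact/measurable_EFinP.
    - by case/integrableP : ig.
    - by move=> z _; rewrite lee_fin.
  rewrite -(fineK (integrable_fin_num _ ig)) //= -/(I _) lee_fin Rintegral_lin //; last first.
    exact: finite_measure_integrable_cst.
  rewrite Rintegral_cst // [X in fine X](_ : _ = 1%E) ?mulr1 /=; last exact: probability_setT.
  have : t^-1 * I (fun z => w n z ^+ 2) <= t.
    rewrite ler_pdivrMl // -expr2; apply: le_trans (Iw n) _.
    by rewrite /t exprAC lerXn2r ?nnegrE ?exprn_ge0 ?invr_ge0 // expr2; lra.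
  by rewrite /t natrX exprVn; lra.
have fin : (\int[mu]_z (\sum_(0 <= n <oo) (w n z)%:E) < +oo)%E.
  rewrite integral_nneseries //; [|by move=> n; exact/measurable_EFinP|].
    apply: (@le_lt_trans _ _ (\sum_(0 <= n <oo) ((4 / (2 ^ (n + 1))%:R)%:E : \bar R))%E).
      apply: lee_nneseries => [n _ _|n _].
        by apply: integral_ge0 => z _; rewrite lee_fin.
      apply: le_trans (Iwn n) _; rewrite lee_fin addn1 expnS natrM invfM.
      by rewrite le_eqVlt; apply/orP; left; apply/eqP; field; rewrite pnatr_eq0 expn_eq0.
    by rewrite (cvg_lim _ (@cvg_geometric_eseries_half R 4 0)) ?ltry.
  by move=> n z _; rewrite lee_fin.
have mS : measurable_fun setT (fun z => \sum_(0 <= n <oo) (w n z)%:E)%E.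
  apply: ge0_emeasurable_sum => [n z _ _|n _]; first by rewrite lee_fin.
  exact/measurable_EFinP.
have : mu.-integrable setT (fun z => \sum_(0 <= n <oo) (w n z)%:E)%E.
  have S0 z : (0 <= \sum_(0 <= n <oo) (w n z)%:E)%E.
    by apply: nneseries_ge0 => n _ _; rewrite lee_fin.
  by apply/integrableP; split => //; under eq_integral do rewrite (gee0_abs (S0 _)).
move=> /integrable_ae => /(_ measurableT); apply: ae_imply => z /(_ Logic.I) zf.
apply: nnseries_is_cvg => //.
by rewrite ltey_eq zf.
Qed.

End finite_measure.

Section square_integrable.
Variables (R : realType) (K : completeNormedModType R[i]).
Variable ip : {dot K for Num.conj}.
Hypothesis ip_norm : forall x : K, ip x x = `|x| ^+ 2.
Hypothesis K_separable : separable K.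
Local Notation C := R[i].
Local Notation T := (circle R).
Local Notation mu := (Defs.arc R).
Local Notation L2 := (@l2 R K).
Local Notation B := (l2ip ip).
Local Notation sq := (sqnorm (l2ip ip)).
Local Notation intg f := (mu.-integrable setT (EFin \o f)).
Local Notation Int f := (Rintegral mu setT f).
Local Notation borel f := (measurable_fun setT (f : T -> g_sigma_algebraType (@open K))).
Implicit Types f g h : T -> K.

Let SI := semi_inner_ip ip_norm.

Lemma rnormZ (a : C) (x : K) : rnorm (a *: x) ^+ 2 = abs2 a * rnorm x ^+ 2.
Proof. by rewrite -!(sq_ip ip_norm) (sqZ SI). Qed.

Lemma l2_borel f : L2 f -> borel f.
Proof. by case. Qed.

Lemma l2_int f : L2 f -> intg (fun z => rnorm (f z) ^+ 2).
Proof. by case. Qed.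

Lemma borel_sq f : borel f -> measurable_fun setT (fun z => rnorm (f z) ^+ 2).
Proof. by move=> mf; apply: measurable_funX; exact: borel_rnorm. Qed.

Lemma l2_le (c : R) f g : borel f -> L2 g ->
  (forall z, rnorm (f z) ^+ 2 <= c * rnorm (g z) ^+ 2) -> L2 f.
Proof.
move=> mf [_ ig] fg; split=> //.
apply: (@integrable_le _ _ _ _ _ (fun z => c * rnorm (g z) ^+ 2 + 0 * rnorm (g z) ^+ 2)).
- exact: borel_sq.
- by move=> z; rewrite mul0r addr0 ger0_norm ?sqr_ge0.
- exact: integrable_lin.
Qed.

Lemma borel_mul (a : T -> C) f : borel f ->
  measurable_fun setT (fun z => complex.Re (a z)) ->
  measurable_fun setT (fun z => complex.Im (a z)) ->
  borel (fun z => a z *: f z).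
Proof.
move=> mf ma1 ma2.
have -> : (fun z => a z *: f z) = (fun z => a z *: f z + 0).
  by apply/funext => z; rewrite addr0.
by apply: (borel_lin ip_norm) => //; exact: measurable_cst.
Qed.

Lemma l2_mul (c : R) (a : T -> C) f : L2 f ->
  measurable_fun setT (fun z => complex.Re (a z)) ->
  measurable_fun setT (fun z => complex.Im (a z)) ->
  (forall z, abs2 (a z) <= c) -> L2 (fun z => a z *: f z).
Proof.
move=> Lf ma1 ma2 ac; apply: (@l2_le c _ f) => //.
  by apply: borel_mul => //; exact: l2_borel.
by move=> z; rewrite rnormZ ler_wpM2r // sqr_ge0.
Qed.

Lemma borelD f g : borel f -> borel g -> borel (f + g).
Proof.
move=> mf mg; rewrite (_ : f + g = (fun z => (1 : C) *: f z + g z)); last first.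
  by apply/funext => z; rewrite scale1r.
by apply: (borel_lin ip_norm) => //; exact: measurable_cst.
Qed.

Lemma l2D f g : L2 f -> L2 g -> L2 (f + g).
Proof.
move=> [mf If] [mg Ig]; split; first exact: borelD.
apply: (@integrable_le _ _ _ _ _
    (fun z => 2 * rnorm (f z) ^+ 2 + 2 * rnorm (g z) ^+ 2)).
- by apply: borel_sq; exact: borelD.
- move=> z; rewrite ger0_norm ?sqr_ge0 //.
  have := @sq_triangle _ _ _ _ SI (f z) 0 (- g z) I I I.
  by rewrite subr0 sub0r !opprK !(sq_ip ip_norm).
- exact: integrable_lin.
Qed.

Lemma l2Z (a : C) f : L2 f -> L2 (a *: f).
Proof.
by move=> Lf; apply: (@l2_mul (abs2 a) (fun=> a)) => //; exact: measurable_cst.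
Qed.

Lemma l2_cst (k : K) : L2 (fun=> k).
Proof.
split; first exact: measurable_cst.
exact: finite_measure_integrable_cst.
Qed.

Lemma linear_l2 : linear_set L2.
Proof.
split; first exact: (l2_cst 0).
by move=> a f g Lf Lg; apply: l2D => //; exact: l2Z.
Qed.

Lemma ip_int f g : L2 f -> L2 g -> intg (fun z => complex.Re (ip (f z) (g z))).
Proof.
move=> [mf If] [mg Ig].
apply: (@integrable_le _ _ _ _ _
    (fun z => 1 * rnorm (f z) ^+ 2 + 1 * rnorm (g z) ^+ 2)).
- exact: borel_ip2.
- move=> z; apply: le_trans (ip_CS ip_norm _ _) _; rewrite !mul1r.
  have := sqr_ge0 (rnorm (f z) - rnorm (g z)).
  by have := mulr_ge0 (rnorm_ge0 (f z)) (rnorm_ge0 (g z)); lra.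
- exact: integrable_lin.
Qed.

Lemma Re_l2ip f g : complex.Re (B f g) = Int (fun z => complex.Re (ip (f z) (g z))).
Proof. by []. Qed.

Lemma Im_l2ip f g : complex.Im (B f g) =
  Int (fun z => complex.Re (ip (f z) ('i%C *: g z))).
Proof. by rewrite /=; apply: eq_Rintegral => z _; rewrite (Im_ip ip_norm). Qed.

Lemma sq_l2 f : sq f = Int (fun z => rnorm (f z) ^+ 2).
Proof. by apply: eq_Rintegral => z _; rewrite -(sq_ip ip_norm). Qed.

Lemma sq_l2E f : L2 f -> (sq f)%:E = (\int[mu]_z (rnorm (f z) ^+ 2)%:E)%E.
Proof. by move=> [_ If]; rewrite sq_l2 fineK //; exact: integrable_fin_num. Qed.

Lemma l2norm_sq f : l2norm f = Num.sqrt (sq f).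
Proof. by rewrite sq_l2. Qed.

Lemma semi_inner_l2 : semi_inner L2 B.
Proof.
split; first exact: linear_l2.
- move=> a f g h Lf Lg Lh.
  have Li : L2 ('i%C *: h) by exact: l2Z.
  have key k : L2 k -> Int (fun z => complex.Re (ip ((a *: f + g) z) (k z))) =
      complex.Re a * Int (fun z => complex.Re (ip (f z) (k z)))
      - complex.Im a * Int (fun z => complex.Im (ip (f z) (k z)))
      + Int (fun z => complex.Re (ip (g z) (k z))).
    move=> Lk.
    have Lik : L2 ('i%C *: k) by exact: l2Z.
    have -> : Int (fun z => complex.Im (ip (f z) (k z))) =
        Int (fun z => complex.Re (ip (f z) (('i%C *: k) z))).
      by apply: eq_Rintegral => z _; rewrite (Im_ip ip_norm).
    have := Rintegral_lin 1 1 (integrable_lin (complex.Re a) (- complex.Im a)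
      (ip_int Lf Lk) (ip_int Lf Lik)) (ip_int Lg Lk).
    rewrite (Rintegral_lin _ _ (ip_int Lf Lk) (ip_int Lf Lik)) !mul1r mulNr => <-.
    apply: eq_Rintegral => z _.
    by rewrite (si_lin SI) // cReD cReM (Im_ip ip_norm) /=; lra.
  apply: complex_ext.
    by rewrite cReD cReM !Re_l2ip key.
  rewrite cImD cImM !Im_l2ip (key _ Li) Re_l2ip.
  have -> : Int (fun z => complex.Im (ip (f z) (('i%C *: h) z))) =
      - Int (fun z => complex.Re (ip (f z) (h z))).
    rewrite -mulN1r -RintegralZl //; last exact: ip_int.
    by apply: eq_Rintegral => z _; rewrite (siZr SI) // cImM cReC cImC /=; lra.
  by rewrite mulrN opprK; lra.
- move=> f g Lf Lg; apply: complex_ext.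
    by rewrite cReC !Re_l2ip; apply: eq_Rintegral => z _; rewrite (reC SI).
  rewrite cImC /= -mulN1r -RintegralZl //.
    by apply: eq_Rintegral => z _; rewrite (siC SI (f := f z)) // cImC mulN1r.
  rewrite (_ : EFin \o _ = EFin \o (fun z => complex.Re (ip (f z) (('i%C *: g) z)))).
    by apply: ip_int => //; exact: l2Z.
  by apply/funext => z /=; rewrite (Im_ip ip_norm).
- move=> f Lf; rewrite -/(sq f) sq_l2; apply: Rintegral_ge0 => z _.
  exact: sqr_ge0.
Qed.

Let BL := semi_inner_l2.

Lemma l2norm_lt f (e : R) : L2 f -> 0 < e -> (l2norm f < e) = (sq f < e ^+ 2).
Proof.
move=> Lf e0; rewrite l2norm_sq -(@ltr_pXn2r _ 2) ?nnegrE ?sqrtr_ge0 ?ltW //.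
by rewrite sqr_sqrtr // (sq_ge0 BL).
Qed.

Lemma l2closureE A : A `<=` L2 -> l2closure A = clos L2 B A.
Proof.
move=> AL; apply/seteqP; split=> f [Lf cf]; split=> // e e0.
  have s0 : 0 < Num.sqrt e by rewrite sqrtr_gt0.
  have [g Ag] := cf _ s0; rewrite l2norm_lt ?sqr_sqrtr ?ltW //; first by exists g.
  by apply: linear_setB => //; [exact: linear_l2|exact: AL].
have [|g Ag fg] := cf (e ^+ 2); first by rewrite exprn_gt0.
exists g => //; rewrite l2norm_lt //.
by apply: linear_setB => //; [exact: linear_l2|exact: AL].
Qed.

Lemma sq_null f : borel f -> {ae mu, forall z, f z = 0} -> sq f = 0.
Proof.
move=> mf f0; rewrite sq_l2 /Rintegral (_ : (\int[mu]_z _)%E = 0%E) //.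
rewrite -(@integral0 _ T R mu setT); apply: ae_eq_integral => //.
  by apply/measurable_EFinP; exact: borel_sq.
by apply: filterS f0 => z fz _; rewrite /= fz rnorm0 expr0n.
Qed.

Lemma sqD_le (a b : R) f g : L2 f -> L2 g -> 0 <= a -> 0 <= b ->
  sq f <= a ^+ 2 -> sq g <= b ^+ 2 -> sq (f + g) <= (a + b) ^+ 2.
Proof.
move=> Lf Lg a0 b0 fa gb; rewrite (sqD BL) //.
suff : complex.Re (B f g) <= a * b by lra.
apply: le_trans (ler_norm _) _.
rewrite -(@ler_pXn2r _ 2) ?nnegrE ?mulr_ge0 // real_normK ?num_real //.
apply: le_trans (rCS BL Lf Lg) _; rewrite exprMn.
by rewrite ler_pM // (sq_ge0 BL).
Qed.

(** Minkowski's inequality applied to the telescoped steps, whose norms are at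
    most [2^-n], [2^-(n+1)], and so on. *)
Lemma tail_bound (u : nat -> T -> K) : (forall n, L2 (u n)) ->
  (forall n, sq (u n.+1 - u n) <= (4^-1) ^+ n) ->
  forall n k, sq (u (n + k)%N - u n) <= 4 * (4^-1) ^+ n.
Proof.
move=> Lu Cu n k.
have r0 m : 0 <= (2^-1 : R) ^+ m by rewrite exprn_ge0 // invr_ge0.
have r1 m : (2^-1 : R) ^+ m <= 1 by rewrite exprn_ile1 // ?invr_ge0 // invf_le1 // ler1n.
have sqr4 m : (4^-1 : R) ^+ m = (2^-1 ^+ m) ^+ 2.
  by rewrite exprAC; congr (_ ^+ m); field.
have LB f g : L2 f -> L2 g -> L2 (f - g) by apply: linear_setB; exact: linear_l2.
have : sq (u (n + k)%N - u n) <= (2 * 2^-1 ^+ n * (1 - 2^-1 ^+ k)) ^+ 2.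
  elim: k => [|k ih].
    by rewrite addn0 subrr expr0 subrr mulr0 expr0n (sq0 BL).
  rewrite addnS -[X in X - _](subrK (u (n + k)%N)) -addrA.
  rewrite (_ : _ * _ * _ = 2^-1 ^+ (n + k) + 2 * 2^-1 ^+ n * (1 - 2^-1 ^+ k)); last first.
    by rewrite exprD exprS; field.
  apply: sqD_le ih => //; try exact: LB.
    by rewrite !mulr_ge0 // subr_ge0.
  by rewrite -sqr4.
move=> /le_trans; apply; rewrite sqr4 (_ : 4 * _ = (2 * 2^-1 ^+ n) ^+ 2); last by ring.
rewrite lerXn2r ?nnegrE ?mulr_ge0 ?subr_ge0 //.
by rewrite ler_piMr ?mulr_ge0 // gerBl.
Qed.

End square_integrable.

Section completeness.
Variables (R : realType) (K : completeNormedModType R[i]).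
Variable ip : {dot K for Num.conj}.
Hypothesis ip_norm : forall x : K, ip x x = `|x| ^+ 2.
Hypothesis K_separable : separable K.
Local Notation C := R[i].
Local Notation T := (circle R).
Local Notation mu := (Defs.arc R).
Local Notation L2 := (@l2 R K).
Local Notation sq := (sqnorm (l2ip ip)).
Local Notation borel f := (measurable_fun setT (f : T -> g_sigma_algebraType (@open K))).
Implicit Types f g h : T -> K.

Let BL := semi_inner_l2 ip_norm K_separable.

Lemma limn_einf_le (v : nat -> \bar R) (c : \bar R) :
  (forall n, v n <= c)%E -> (limn_einf v <= c)%E.
Proof.
move=> vc; rewrite limn_einf_lim; apply: lime_le; first exact: is_cvg_einfs.
apply: nearW => n; apply: le_trans (vc n).
by apply: ereal_inf_lbound; exists n => /=.
Qed.

Lemma ae_fast_cauchy (u : nat -> T -> K) : (forall n, L2 (u n)) ->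
  (forall n, sq (u n.+1 - u n) <= (4^-1) ^+ n) ->
  {ae mu, forall z, cvgn (fun n => u n z)}.
Proof.
move=> Lu Cu.
have Ld n : L2 (u n.+1 - u n).
  by apply: linear_setB => //; exact: (linear_l2 ip_norm).
have : {ae mu, forall z, cvgn (series (fun n => rnorm (u n.+1 z - u n z)))}.
  apply: ae_cvg_series.
  - by move=> n; apply: borel_rnorm; exact: l2_borel (Ld n).
  - by move=> n z; exact: rnorm_ge0.
  - by move=> n; exact: l2_int (Ld n).
  - by move=> n; rewrite -(sq_l2 ip_norm (u n.+1 - u n)).
by apply: ae_imply => z; exact: cvg_summable_steps.
Qed.

(** Riesz-Fischer: off a null set the sequence converges pointwise, and Fatou's
    lemma turns the uniform tail bound into convergence in norm. *)
Lemma complete_l2 : complete_for L2 (l2ip ip).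
Proof.
move=> u Lu Cu.
have [N [mN N0 NP]] := ae_fast_cauchy Lu Cu.
(* Setting the functions to 0 on the exceptional set makes them converge
   everywhere, so that the limit is measurable. *)
pose a z : C := (\1_(~` N) z)%:C%C.
have a01 z : a z = 0 \/ a z = 1 by rewrite /a indicE; case: (z \in _); [right|left].
pose f n z := a z *: u n z.
have Lf n : L2 (f n).
  apply: (@l2_mul _ _ _ ip_norm K_separable 1) => //.
  - exact: measurable_indic (measurableC mN).
  - by move=> z; case: (a01 z) => ->; rewrite /abs2 /= ?expr1n expr0n ?addr0 ?expr0n.
have cf z : cvgn (fun n => f n z).
  have [Nz|Nz] := pselect (N z).
    have -> : (fun n => f n z) = (fun=> 0).
      apply/funext => n; rewrite /f /a indicE memNset ?scale0r //=.
    exact: is_cvg_cst.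
  have -> : (fun n => f n z) = (fun n => u n z).
    by apply/funext => n; rewrite /f /a indicE mem_set // scale1r.
  by apply: contrapT => h; apply: Nz; apply: NP.
pose g z := limn (fun n => f n z).
have fg z : f ^~ z @ \oo --> g z := cf z.
have mg : borel g by apply: (borel_cvg ip_norm K_separable _ fg) => n; exact: l2_borel.
have uf0 n : sq (u n - f n) = 0.
  have LB : L2 (u n - f n).
    by apply: linear_setB => //; exact: (linear_l2 ip_norm).
  apply: (sq_null ip_norm (l2_borel LB)).
  exists N; split => // z /= h; apply: contrapT => Nz; apply: h.
  rewrite /f /a -[(u n - _) z]/(u n z - _) indicE mem_set // scale1r subrr //.
have tail n k : sq (f (n + k)%N - f n) <= 4 * (4^-1) ^+ n.
  have := tail_bound ip_norm K_separable Lu Cu n k; apply: le_trans.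
  have Lr m l : L2 (u m - u l) by apply: linear_setB => //; exact: (linear_l2 ip_norm).
  have Lr' m l : L2 (f m - f l) by apply: linear_setB => //; exact: (linear_l2 ip_norm).
  rewrite -lee_fin !sq_l2E //; apply: ge0_le_integral => //.
  - by move=> z _; rewrite lee_fin sqr_ge0.
  - by apply/measurable_EFinP; apply: borel_sq; exact: l2_borel (Lr' _ _).
  - by apply/measurable_EFinP; apply: borel_sq; exact: l2_borel (Lr _ _).
  - move=> z _; rewrite lee_fin /f -[(_ - _) z]/(a z *: u (n + k)%N z - a z *: u n z).
    rewrite -scalerBr (rnormZ ip_norm).
    by case: (a01 z) => ->; rewrite /abs2 /= ?expr1n expr0n ?addr0 ?expr0n ?mul0r ?mul1r ?sqr_ge0.
have bfg n : borel (g - f n).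
  have Lnf : L2 (- f n) by apply: linear_setN => //; exact: (linear_l2 ip_norm).
  by apply: (borelD ip_norm K_separable) => //; exact: l2_borel Lnf.
have fatou_bound n : (\int[mu]_z (rnorm ((g - f n) z) ^+ 2)%:E <= (4 * (4^-1) ^+ n)%:E)%E.
  pose v k z := (rnorm ((f (n + k)%N - f n) z) ^+ 2)%:E.
  have Lr k : L2 (f (n + k)%N - f n).
    by apply: linear_setB => //; exact: (linear_l2 ip_norm).
  have vlim z : v ^~ z @ \oo --> (rnorm ((g - f n) z) ^+ 2)%:E.
    apply: cvg_EFin; first by apply: nearW.
    rewrite /v /comp /=.
    pose h (x : K) := rnorm (x - f n z) ^+ 2.
    have ch : {for g z, continuous h}.
      apply: (@continuous_comp _ _ _ (fun x : K => rnorm (x - f n z)) (fun x : R => x ^+ 2));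
        last exact: exprn_continuous.
      apply: (@continuous_comp _ _ _ (fun x : K => x - f n z)); last exact: rnorm_continuous.
      by apply: cvgB; [exact: cvg_id|exact: cvg_cst].
    suff : (fun k => h (f (n + k)%N z)) @ \oo --> h (g z) by [].
    apply: (continuous_cvg _ ch).
    rewrite (_ : (fun k => f (n + k)%N z) = (fun k => f (k + n)%N z)).
      by rewrite (cvg_shiftn n (fun k => f k z)); exact: fg.
    by apply/funext => k; rewrite addnC.
  rewrite (eq_integral (fun z => limn_einf (v ^~ z))); last first.
    by move=> z _; have [-> _] := cvg_limn_einf_sup (vlim z).
  apply: le_trans (fatou _ _ _ _) _ => //.
  - by move=> k; apply/measurable_EFinP; apply: borel_sq; exact: l2_borel (Lr k).
  - by move=> k z _; rewrite lee_fin sqr_ge0.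
  apply: limn_einf_le => k; rewrite -(sq_l2E ip_norm) // lee_fin; exact: tail.
have Lgf n : L2 (g - f n).
  split=> //; apply/integrableP; split.
    by apply/measurable_EFinP; exact: borel_sq.
  apply: (@le_lt_trans _ _ (4 * (4^-1) ^+ n)%:E); last exact: ltry.
  apply: le_trans (fatou_bound n); apply: ge0_le_integral => //.
  - by apply: measurableT_comp => //; apply/measurable_EFinP; exact: borel_sq.
  - by apply/measurable_EFinP; exact: borel_sq.
  - by move=> z _; rewrite gee0_abs // lee_fin sqr_ge0.
have Lg : L2 g by rewrite -(subrK (f 0%N) g); exact: l2D.
exists g => // e e0.
have e8 : 0 < e / 8 by rewrite divr_gt0.
have r0 : 0 <= (4^-1 : R) by lra.
have r1 : (4^-1 : R) < 1 by lra.
apply: filterS (expr_small r0 r1 e8) => n ne.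
have LB : L2 (u n - f n) by apply: linear_setB => //; exact: (linear_l2 ip_norm).
have := sq_triangle BL (Lu n) (Lf n) Lg; rewrite uf0 (sqBC BL (Lf n) Lg).
have : sq (g - f n) <= 4 * (4^-1) ^+ n by rewrite -lee_fin sq_l2E.
lra.
Qed.

End completeness.

(** * Polynomial approximation of indicators *)

Section step_approximation.
Variable R : realType.
Implicit Types x y r : R.

Lemma bernoulli_ge x N : -1 <= x -> 1 + N%:R * x <= (1 + x) ^+ N.
Proof.
move=> x1; elim: N => [|N ih]; first by rewrite mul0r addr0 expr0.
rewrite exprS; apply: (@le_trans _ _ ((1 + x) * (1 + N%:R * x))).
  rewrite -subr_ge0 (_ : _ - _ = N%:R * x ^+ 2).
    by rewrite mulr_ge0 ?ler0n // sqr_ge0.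
  by rewrite -[N.+1%:R]natr1; ring.
by rewrite ler_wpM2l //; lra.
Qed.

Lemma cvg_natr_expr r : 0 <= r -> r < 1 -> (fun n => n%:R * r ^+ n) @ \oo --> (0 : R).
Proof.
move=> r0 r1; have [->|rn0] := eqVneq r 0.
  apply: (@cvg_near_cst _ _ 0); exists 1%N => // n /= n1.
  by rewrite expr0n gtn_eqF // mulr0.
(* [n r^n = (n s^n) s^n] for [s^2 = r], and [n s^n] is bounded. *)
pose s := Num.sqrt r; have sr : s ^+ 2 = r by rewrite sqr_sqrtr.
have s0 : 0 < s by rewrite sqrtr_gt0 lt_neqAle eq_sym rn0.
have s1 : s < 1 by rewrite -(@ltr_pXn2r _ 2) ?nnegrE ?ltW // sr expr1n.
pose h := s^-1 - 1; have h0 : 0 < h by rewrite subr_gt0 invf_gt1.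
apply: (@squeeze_cvgr _ _ _ _ (fun=> 0) (fun n => h^-1 * s ^+ n)).
- apply: nearW => n; rewrite mulr_ge0 ?ler0n ?exprn_ge0 //=.
  have : n%:R * s ^+ n <= h^-1.
    have := @bernoulli_ge h n; rewrite (_ : 1 + h = s^-1) ?exprVn; last first.
      by rewrite /h addrC subrK.
    move=> b; rewrite -ler_pdivlMr ?exprn_gt0 // mulrC ler_pdivlMr //.
    by apply: le_trans (b _); [rewrite lerDr|lra].
  rewrite -sr exprAC => b.
  rewrite (_ : _ * _ = n%:R * s ^+ n * s ^+ n); last by rewrite expr2; ring.
  by rewrite ler_wpM2r // exprn_ge0 // ltW.
- exact: cvg_cst.
- rewrite -(mulr0 h^-1); apply: cvgM; first exact: cvg_cst.
  by apply: cvg_expr; rewrite ger0_norm // ltW.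
Qed.

(** These polynomials converge to the indicator of [y < 1/2] on all of [0, 1],
    the exponent [n 2^n] being just large enough to decide the case [y = 1/2]. *)
Lemma cvg_step y : 0 <= y -> y <= 1 ->
  (fun n => (1 - y ^+ n) ^+ (n * 2 ^ n)) @ \oo --> ((y < 2^-1)%R%:R : R).
Proof.
move=> y0 y1.
have x01 n : 0 <= y ^+ n <= 1 by rewrite exprn_ge0 // exprn_ile1.
have Nx n : (n * 2 ^ n)%:R * y ^+ n = n%:R * (2 * y) ^+ n.
  by rewrite natrM natrX exprMn mulrA.
have q01 n : 0 <= (1 - y ^+ n) ^+ (n * 2 ^ n) <= 1.
  by have /andP[? ?] := x01 n; rewrite exprn_ge0 ?exprn_ile1 ?subr_ge0 ?gerBl.
case: ltP => yh /=.
  apply: (@squeeze_cvgr _ _ _ _ (fun n => 1 - n%:R * (2 * y) ^+ n) (fun=> 1)).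
  - apply: nearW => n; have /andP[_ ->] := q01 n; rewrite andbT -Nx -mulrN.
    by apply: bernoulli_ge; rewrite lerN2; have /andP[] := x01 n.
  - rewrite -[X in _ --> X](subr0 1); apply: cvgB; first exact: cvg_cst.
    by apply: cvg_natr_expr; lra.
  - exact: cvg_cst.
apply: (@squeeze_cvgr _ _ _ _ (fun=> 0) (fun n => n.+1%:R^-1)).
- apply: nearW => n; have /andP[-> _] := q01 n; rewrite /=.
  have /andP[x0 x1] := x01 n; set x := y ^+ n in x0 x1 *; set N := (n * 2 ^ n)%N.
  rewrite -[leRHS]mul1r ler_pdivlMr ?ltr0n //.
  apply: (@le_trans _ _ ((1 - x) ^+ N * (1 + x) ^+ N)).
    rewrite ler_wpM2l ?exprn_ge0 ?subr_ge0 //.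
    apply: le_trans (bernoulli_ge _ _); last lra.
    rewrite /x /N Nx -natr1 addrC lerD2l ler_peMr ?ler0n //.
    by rewrite exprn_ege1 //; lra.
  by rewrite -exprMn exprn_ile1 //; nra.
- exact: cvg_cst.
- exact: cvg_harmonic.
Qed.

End step_approximation.

(** * Multiplication operators and reducing subspaces *)

(** [z |-> z^n f(z)]: the powers of the bilateral shift, which extends the
    unilateral one to a unitary. *)
Definition zpow (R : realType) (K : completeNormedModType R[i]) (n : int)
  (f : circle R -> K) : circle R -> K := fun z => (val z : R[i]) ^ n *: f z.

Section bilateral_shift.
Variables (R : realType) (K : completeNormedModType R[i]).
Variable ip : {dot K for Num.conj}.
Hypothesis ip_norm : forall x : K, ip x x = `|x| ^+ 2.
Hypothesis K_separable : separable K.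
Local Notation C := R[i].
Local Notation T := (circle R).
Local Notation mu := (Defs.arc R).
Local Notation L2 := (@l2 R K).
Local Notation B := (l2ip ip).
Local Notation sq := (sqnorm (l2ip ip)).
Local Notation Int f := (Rintegral mu setT f).
Local Notation "\z z" := (val z : C) (at level 8, z at level 8, format "\z z").
Implicit Types f g h : T -> K.

Let SI := semi_inner_ip ip_norm.
Let BL := semi_inner_l2 ip_norm K_separable.
Let LL := linear_l2 ip_norm K_separable.

Lemma abs2_z (z : T) : abs2 (\z z) = 1.
Proof.
have : `|\z z| = 1 := set_mem (valP z).
rewrite normc_def => -[]; rewrite -/(abs2 _) => h.
by rewrite -[LHS](@sqr_sqrtr R) ?abs2_ge0 // h expr1n.
Qed.

Lemma z_neq0 (z : T) : \z z != 0.
Proof.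
apply/eqP => z0; have := abs2_z z; rewrite z0 /abs2 /= expr0n addr0 => /eqP.
by rewrite eq_sym oner_eq0.
Qed.

Lemma zV (z : T) : (\z z)^-1 = (\z z)^*.
Proof.
apply: (mulfI (z_neq0 z)); rewrite mulCconj abs2_z mulfV ?z_neq0 //.
Qed.

Lemma zN (z : T) n : \z z ^ (- n) = (\z z ^ n)^*.
Proof.
by rewrite -exprz_inv zV; case: n => n; rewrite /exprz ?fmorphV rmorphXn.
Qed.

Lemma abs2_zn (z : T) n : abs2 (\z z ^ n) = 1.
Proof.
have : (abs2 (\z z ^ n))%:C%C = 1.
  by rewrite -mulCconj -zN -expfzDr ?z_neq0 // subrr expr0z.
by move=> [].
Qed.

Lemma zpowD m n f : zpow m (zpow n f) = zpow (m + n) f.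
Proof. by apply/funext => z; rewrite /zpow scalerA -expfzDr ?z_neq0. Qed.

Lemma zpow0 f : zpow 0 f = f.
Proof. by apply/funext => z; rewrite /zpow expr0z scale1r. Qed.

Lemma zpowK n f : zpow (- n) (zpow n f) = f.
Proof. by rewrite zpowD addNr zpow0. Qed.

Lemma zpow_lin n (a : C) f g : zpow n (a *: f + g) = a *: zpow n f + zpow n g.
Proof.
apply/funext => z; rewrite /zpow -[(a *: f + g) z]/(a *: f z + g z).
by rewrite -[RHS]/(a *: _ + _) scalerDr !scalerA mulrC.
Qed.

Lemma zpowB n f g : zpow n (f - g) = zpow n f - zpow n g.
Proof.
apply/funext => z; rewrite /zpow -[(f - g) z]/(f z - g z).
by rewrite -[RHS]/(_ - _) scalerBr.
Qed.

Lemma shiftE f : Defs.shift f = zpow 1 f.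
Proof. by apply/funext => z; rewrite /zpow expr1z. Qed.

Lemma val_open (V : set C^o) : open V -> measurable [set z : T | V (\z z)].
Proof. by move=> oV; apply: sub_sigma_algebra; exists V. Qed.

Lemma measurable_val (p : C -> R) : (forall x y, `|p x - p y| <= complex.Re `|x - y|) ->
  measurable_fun setT (fun z : T => p (\z z)).
Proof.
move=> lip; apply: (measurability _ (@RGenOpens.measurableE R)) => _ [_ [a [b ->]] <-].
rewrite setTI; have oV : open ((p @^-1` `]a, b[) : set C^o).
  rewrite openE => x /=; rewrite in_itv /= => /andP[ax xb]; apply/nbhs_ballP.
  exists (Num.min (p x - a) (b - p x))%:C%C; first by rewrite /= ltcR lt_min !subr_gt0 ax.
  move=> y; rewrite -ball_normE /ball_ /= ltcE => /andP[_ /=].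
  move=> /(le_lt_trans (lip x y)); rewrite lt_min !ltr_norml in_itv /=.
  by move=> /andP[/andP[? ?] /andP[? ?]]; apply/andP; split; lra.
exact: (val_open oV).
Qed.

Lemma measurable_Re_val : measurable_fun setT (fun z : T => complex.Re (\z z)).
Proof.
apply: measurable_val => x y; rewrite -cReN -cReD normc_def /= -sqrtr_sqr.
by rewrite ler_wsqrtr // lerDl sqr_ge0.
Qed.

Lemma measurable_Im_val : measurable_fun setT (fun z : T => complex.Im (\z z)).
Proof.
apply: measurable_val => x y; rewrite -cImN -cImD normc_def /= -sqrtr_sqr.
by rewrite ler_wsqrtr // lerDr sqr_ge0.
Qed.

Lemma measurable_zn n : measurable_fun setT (fun z : T => complex.Re (\z z ^ n)) /\
  measurable_fun setT (fun z : T => complex.Im (\z z ^ n)).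
Proof.
wlog [m ->] : n / exists m : nat, n = m.
  move=> wl; case: n => n; first by apply: wl; exists n.
  have [r i] := wl _ (ex_intro _ n.+1 erefl).
  split.
    rewrite (_ : (fun z => _) = (fun z : T => complex.Re (\z z ^ n.+1))) //.
    by apply/funext => z; rewrite NegzE zN cReC.
  rewrite (_ : (fun z => _) = (fun z : T => - complex.Im (\z z ^ n.+1))).
    exact: measurable_funN.
  by apply/funext => z; rewrite NegzE zN cImC.
elim: m => [|m [r i]]; first by split; exact: measurable_cst.
have eE (z : T) : \z z ^ m.+1 = \z z * \z z ^ m by rewrite exprSz.
split.
  rewrite (_ : (fun z => _) = (fun z : T => complex.Re (\z z) * complex.Re (\z z ^ m)
      - complex.Im (\z z) * complex.Im (\z z ^ m))).
    by apply: measurable_funB; apply: measurable_funM => //;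
      [exact: measurable_Re_val|exact: measurable_Im_val].
  by apply/funext => z; rewrite eE cReM.
rewrite (_ : (fun z => _) = (fun z : T => complex.Re (\z z) * complex.Im (\z z ^ m)
    + complex.Im (\z z) * complex.Re (\z z ^ m))).
  by apply: measurable_funD; apply: measurable_funM => //;
    [exact: measurable_Re_val|exact: measurable_Im_val].
by apply/funext => z; rewrite eE cImM.
Qed.

Lemma l2_zpow n f : L2 f -> L2 (zpow n f).
Proof.
move=> Lf; have [r i] := measurable_zn n.
by apply: (l2_mul ip_norm K_separable (c := 1)) => // z; rewrite abs2_zn.
Qed.

Lemma zpow_unitary n f g : B (zpow n f) (zpow n g) = B f g.
Proof.
rewrite /l2ip; congr cintegral; apply/funext => z.
by rewrite /zpow (siZl SI) // (siZr SI) // mulrA mulCconj abs2_zn mul1r.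
Qed.

Lemma zpow_adjoint n f g : B (zpow n f) g = B f (zpow (- n) g).
Proof. by rewrite -(zpow_unitary (- n)) zpowK. Qed.

Lemma sq_zpow n f : sq (zpow n f) = sq f.
Proof. by rewrite /sq zpow_unitary. Qed.

(** Real multipliers [p] that preserve a closed subspace invariant under both
    shifts form an algebra closed under bounded pointwise limits. It contains
    [Re z] and [Im z], hence polynomials in them, hence the indicators of
    half-planes, and finally those of all Borel sets. *)
Section reducing_subspace.
Variable Z : set (T -> K).
Hypotheses (LZ : linear_set Z) (ZL : Z `<=` L2) (cZ : clos L2 B Z `<=` Z).
Hypothesis (Z1 : forall f, Z f -> Z (zpow 1 f)).
Hypothesis (ZN1 : forall f, Z f -> Z (zpow (-1) f)).

Definition multiplier (p : T -> R) := [/\ measurable_fun setT p,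
  (exists c, forall z, `|p z| <= c) &
  forall f, Z f -> Z (fun z => (p z)%:C%C *: f z)].

Lemma multiplier_cst c : multiplier (fun=> c).
Proof.
split; [exact: measurable_cst|by exists (`|c|)|].
by move=> f Zf; exact: (linear_setZ c%:C%C LZ Zf).
Qed.

Lemma multiplierD p q : multiplier p -> multiplier q -> multiplier (fun z => p z + q z).
Proof.
move=> [mp [c pc] Zp] [mq [d qd] Zq]; split; first exact: measurable_funD.
  by exists (c + d) => z; apply: le_trans (ler_normD _ _) _; rewrite lerD.
move=> f Zf; have := linear_setD LZ (Zp _ Zf) (Zq _ Zf); congr Z.
by apply/funext => z; rewrite rmorphD scalerDl.
Qed.

Lemma multiplierM p q : multiplier p -> multiplier q -> multiplier (fun z => p z * q z).
Proof.
move=> [mp [c pc] Zp] [mq [d qd] Zq]; split; first exact: measurable_funM.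
  by exists (c * d) => z; rewrite normrM ler_pM.
move=> f Zf; have := Zp _ (Zq _ Zf); congr Z.
by apply/funext => z; rewrite rmorphM scalerA.
Qed.

Lemma multiplierZ c p : multiplier p -> multiplier (fun z => c * p z).
Proof. by move=> mp; apply: multiplierM => //; exact: multiplier_cst. Qed.

Lemma multiplier_1B p : multiplier p -> multiplier (fun z => 1 - p z).
Proof.
move=> mp; rewrite (_ : (fun z => _) = (fun z => 1 + -1 * p z)).
  by apply: multiplierD; [exact: multiplier_cst|exact: multiplierZ].
by apply/funext => z; rewrite mulN1r.
Qed.

Lemma multiplierX n p : multiplier p -> multiplier (fun z => p z ^+ n).
Proof.
move=> mp; elim: n => [|n ih]; first exact: multiplier_cst.
rewrite (_ : (fun z => _) = (fun z => p z * p z ^+ n)); first exact: multiplierM.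
by apply/funext => z; rewrite exprS.
Qed.

Lemma abs2_val_le1 (z : T) : `|complex.Re (\z z)| <= 1 /\ `|complex.Im (\z z)| <= 1.
Proof.
have := abs2_z z; rewrite /abs2 => e; split; rewrite -(@ler_pXn2r _ 2) ?nnegrE //.
  by rewrite real_normK ?num_real // expr1n -e lerDl sqr_ge0.
by rewrite real_normK ?num_real // expr1n -e lerDr sqr_ge0.
Qed.

Lemma multiplier_Re : multiplier (fun z => complex.Re (\z z)).
Proof.
split; [exact: measurable_Re_val|by exists 1 => z; case: (abs2_val_le1 z)|].
move=> f Zf; have := linear_setZ ((2^-1)%:C%C) LZ (linear_setD LZ (Z1 Zf) (ZN1 Zf)).
congr Z; apply/funext => z; rewrite -[LHS]/((2^-1)%:C%C *: (zpow 1 f z + zpow (-1) f z)).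
rewrite /zpow -scalerDl scalerA; congr (_ *: _).
by rewrite zN expr1z; apply: complex_ext; rewrite !ReImE /=; field.
Qed.

Lemma multiplier_Im : multiplier (fun z => complex.Im (\z z)).
Proof.
split; [exact: measurable_Im_val|by exists 1 => z; case: (abs2_val_le1 z)|].
move=> f Zf; have := linear_setZ (0 -i* 2^-1)%C LZ (linear_setB LZ (Z1 Zf) (ZN1 Zf)).
congr Z; apply/funext => z; rewrite -[LHS]/((0 -i* 2^-1)%C *: (zpow 1 f z - zpow (-1) f z)).
rewrite /zpow -scalerBl scalerA; congr (_ *: _).
by rewrite zN expr1z; apply: complex_ext; rewrite !ReImE /=; field.
Qed.

(** Dominated convergence, with [4 |f(z)|^2] as a majorant, and closedness of
    [Z]. *)
Lemma multiplier_lim (p_ : nat -> T -> R) (p : T -> R) : (forall n, multiplier (p_ n)) ->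
  (forall n z, `|p_ n z| <= 1) ->
  (forall z, p_ ^~ z @ \oo --> p z) -> multiplier p.
Proof.
move=> mp_ p1 pp.
have mp : measurable_fun setT p.
  by apply: (measurable_fun_cvg _ (fun z _ => pp z)) => n; case: (mp_ n).
have pb z : `|p z| <= 1.
  have h : `|p_ n z| @[n --> \oo] --> `|p z| by apply: cvg_norm; exact: pp.
  rewrite -(cvg_lim (@Rhausdorff R) h).
  by apply: limr_le; [exact: cvgP h|exact: nearW].
split=> //; first by exists 1.
move=> f Zf; have Lf := ZL Zf.
have Lq (q : T -> R) : measurable_fun setT q -> (forall z, `|q z| <= 1) ->
    L2 (fun z => (q z)%:C%C *: f z).
  move=> mq q1; apply: (l2_mul ip_norm K_separable (c := 1)) => //.
  by move=> z; rewrite /abs2 /= expr0n addr0 -real_normK ?num_real // expr_le1.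
have Lp := Lq _ mp pb.
have mpn n : measurable_fun setT (p_ n) by case: (mp_ n).
have Lpn n := Lq _ (mpn n) (p1 n).
have Zpn n : Z (fun z => (p_ n z)%:C%C *: f z) by case: (mp_ n) => _ _; apply.
apply: cZ; split=> // e e0.
pose d n z := (`|p z - p_ n z| ^+ 2 * rnorm (f z) ^+ 2)%:E.
have dE n z : d n z =
    (rnorm (((fun z => (p z)%:C%C *: f z) - (fun z => (p_ n z)%:C%C *: f z)) z) ^+ 2)%:E.
  rewrite -[(_ - _) z]/((p z)%:C%C *: f z - (p_ n z)%:C%C *: f z) -scalerBl -rmorphB.
  by rewrite /d (rnormZ ip_norm) /abs2 /= expr0n addr0 real_normK ?num_real.
have LB n : L2 ((fun z => (p z)%:C%C *: f z) - (fun z => (p_ n z)%:C%C *: f z)).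
  exact: linear_setB.
have md n : measurable_fun setT (d n).
  rewrite (_ : d n = EFin \o (fun z => rnorm (((fun z => (p z)%:C%C *: f z)
     - (fun z => (p_ n z)%:C%C *: f z)) z) ^+ 2)); last by apply/funext => z; rewrite dE.
  by apply/measurable_EFinP; apply: borel_sq; exact: l2_borel (LB n).
have : (\int[mu]_z d n z)%E @[n --> \oo] --> 0%E.
  have <- : (\int[mu]_z (cst 0%E z))%E = 0%E by exact: integral0.
  apply: (@dominated_cvg _ _ _ _ _ _ _ _ (fun z => (4 * rnorm (f z) ^+ 2)%:E)) => //.
  - move=> z _; apply: cvg_EFin; first by apply: nearW.
    rewrite (_ : fine \o _ = (fun n => `|p z - p_ n z| ^+ 2 * rnorm (f z) ^+ 2)) //.
    have -> : 0 = `|p z - p z| ^+ 2 * rnorm (f z) ^+ 2.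
      by rewrite subrr normr0 expr0n mul0r.
    apply: cvgM; last exact: cvg_cst.
    apply: (continuous_cvg _ (@exprn_continuous R 2 _)).
    by apply: cvg_norm; apply: cvgB; [exact: cvg_cst|exact: pp].
  - have := integrable_lin 4 0 (l2_int Lf) (l2_int Lf); congr (_.-integrable _ _).
    by apply/funext => z /=; rewrite mul0r addr0.
  - move=> n z _; rewrite /d gee0_abs ?lee_fin; last by rewrite mulr_ge0 // sqr_ge0.
    rewrite ler_wpM2r ?sqr_ge0 // (_ : 4 = 2 ^+ 2); last by ring.
    rewrite lerXn2r ?nnegrE //; apply: le_trans (ler_normB _ _) _.
    by rewrite (natrD _ 1 1) lerD.
move=> /fine_cvgP[_] /cvgrPdist_lt /(_ _ e0) [n _ /(_ n (leqnn n))] /= ne.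
exists (fun z => (p_ n z)%:C%C *: f z) => //.
rewrite (sq_l2 ip_norm) /Rintegral; move: ne; rewrite sub0r normrN.
under [in X in X -> _]eq_integral do rewrite dE.
by apply: le_lt_trans; exact: ler_norm.
Qed.

(** The affine map [y] sends [-1, 1] into [0, 1] and [c] to [1/2], which reduces
    the indicator of [p < c] to [cvg_step]. *)
Lemma multiplier_lt (p : T -> R) c : multiplier p -> (forall z, `|p z| <= 1) ->
  multiplier (\1_[set z | p z < c]).
Proof.
move=> mp p1; pose y z := 2^-1 + (2 * (1 + `|c|))^-1 * (p z + - c).
have my : multiplier y.
  apply: multiplierD; first exact: multiplier_cst.
  by apply: multiplierZ; apply: multiplierD => //; exact: multiplier_cst.
have d0 : 0 < 1 + `|c| by rewrite ltr_pwDl.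
have y01 z : 0 <= y z <= 1.
  have : `|p z - c| <= 1 + `|c| by apply: le_trans (ler_normB _ _) _; rewrite lerD2r.
  rewrite ler_norml => /andP[l r].
  rewrite (_ : y z = (1 + `|c| + (p z - c)) / (2 * (1 + `|c|))); last first.
    by rewrite /y; field; rewrite gt_eqF.
  apply/andP; split; last by rewrite ler_pdivrMr ?mulr_gt0 //; lra.
  by apply: divr_ge0; lra.
have yc z : (y z < 2^-1) = (p z < c).
  rewrite /y gtrDl pmulr_rlt0 ?subr_lt0 //.
apply: (multiplier_lim (p_ := fun n z => (1 - y z ^+ n) ^+ (n * 2 ^ n))).
- by move=> n; apply: multiplierX; apply: multiplier_1B; exact: multiplierX.
- move=> n z; have /andP[y0 y1] := y01 z; rewrite normrX exprn_ile1 //.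
  by rewrite ger0_norm ?subr_ge0 ?gerBl ?exprn_ge0 ?exprn_ile1.
- move=> z; rewrite indicE; have /andP[y0 y1] := y01 z.
  rewrite (_ : (z \in _) = (y z < 2^-1)); first exact: cvg_step.
  by rewrite yc; apply/idP/idP; rewrite inE.
Qed.

Definition multiplier_set : set (set T) := [set A | multiplier (\1_A)].

Lemma multiplier_sigma_algebra : sigma_algebra setT multiplier_set.
Proof.
have gC A : multiplier_set A -> multiplier_set (setT `\` A).
  move=> gA; rewrite /multiplier_set /= (_ : \1_(setT `\` A) = (fun z => 1 - \1_A z)); first exact: multiplier_1B.
  by apply/funext => z; rewrite setTD !indicE in_setC; case: (z \in A); rewrite ?subrr ?subr0.
split=> //.
  by rewrite /multiplier_set /= indic0; exact: multiplier_cst.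
move=> F gF.
have gP n : multiplier (fun z => \prod_(k < n) (1 - \1_(F k) z : R)).
  elim: n => [|n ih].
    rewrite (_ : (fun z => _) = fun=> 1); first exact: multiplier_cst.
    by apply/funext => z; rewrite big_ord0.
  rewrite (_ : (fun z => _) = (fun z => \prod_(k < n) (1 - \1_(F k) z : R) * (1 - \1_(F n) z))).
    by apply: multiplierM => //; apply: multiplier_1B; exact: gF.
  by apply/funext => z; rewrite big_ord_recr.
have i01 A (z : T) : 0 <= 1 - (\1_A z : R) <= 1.
  by rewrite indicE; case: (z \in A); rewrite ?subrr ?subr0 lexx ?ler01.
apply: (multiplier_lim (p_ := fun n z => 1 - \prod_(k < n) (1 - \1_(F k) z : R))).
- by move=> n; exact: multiplier_1B.
- move=> n z; have /andP[p0 p1] : 0 <= \prod_(k < n) (1 - \1_(F k) z : R) <= 1.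
    by rewrite prodr_ile1 ?prodr_ge0 // => k _; case/andP: (i01 (F k) z) => // -> ->.
  by rewrite ger0_norm ?subr_ge0 // gerBl.
- move=> z; rewrite indicE; have [[k _ Fk]|nF] := pselect ((\bigcup_k F k) z).
    rewrite mem_set; last by exists k.
    apply: cvg_near_cst; exists k.+1 => // n /= kn.
    by rewrite (bigD1 (Ordinal kn)) //= indicE mem_set // subrr mul0r subr0.
  rewrite memNset //; apply: cvg_near_cst; apply: nearW => n.
  rewrite big1 ?subrr // => k _; rewrite indicE memNset ?subr0 // => Fk.
  by apply: nF; exists k.
Qed.

(** An open set is a countable union of half-open boxes with rational lower corners
    and side [1/(m+1)], and boxes are made of half-planes. *)
Lemma open_multiplier : @open (circle_point R) `<=` multiplier_set.
Proof.
move=> _ [V oV <-].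
pose G : set (set T) := [set A | exists c, A = [set z | complex.Re (\z z) < c] \/
                                          A = [set z | complex.Im (\z z) < c]].
have Gmult : G `<=` multiplier_set.
  move=> _ [c [->|->]]; apply: multiplier_lt; try (by move=> z; case: (abs2_val_le1 z)).
    exact: multiplier_Re.
  exact: multiplier_Im.
apply: (smallest_sub multiplier_sigma_algebra Gmult).
rewrite -[X in smallest _ _ X]/(_ @^-1` V) -/(G.-sigma.-measurable _).
pose strip (p : T -> R) (q : rat) (m : nat) := [set z | ratr q <= p z < ratr q + m.+1%:R^-1].
have mstrip (p : T -> R) q m : (forall c, G.-sigma.-measurable [set z | p z < c]) ->
    G.-sigma.-measurable (strip p q m).
  move=> mp; rewrite (_ : strip _ _ _ = [set z | p z < ratr q + m.+1%:R^-1] `\` [set z | p z < ratr q]).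
    exact: measurableD.
  apply/seteqP; split=> z /=.
    by move=> /andP[l r]; split=> //; apply/negP; rewrite -leNgt.
  by move=> [r /negP]; rewrite -leNgt => l; apply/andP.
have mG A : G A -> G.-sigma.-measurable A by move=> GA; exact: sub_sigma_algebra.
pose box q1 q2 m := strip (fun z => complex.Re (\z z)) q1 m `&` strip (fun z => complex.Im (\z z)) q2 m.
have mbox q1 q2 m : G.-sigma.-measurable (box q1 q2 m).
  apply: measurableI; apply: mstrip => c; apply: mG; exists c; by [left|right].
have -> : set_val @^-1` V = \bigcup_m \bigcup_q1 \bigcup_q2
    [set z | box q1 q2 m z /\ box q1 q2 m `<=` set_val @^-1` V].
  apply/seteqP; split=> [z Vz|z [m _ [q1 _ [q2 _ [bz bV]]]]]; last exact: bV.
  have /nbhs_ballP[e /= /Re_pos[e0 eE] eV] := open_nbhs_nbhs (conj oV Vz).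
  have /ltr_add_invr[m] : 0 < complex.Re e / 2 by rewrite divr_gt0.
  rewrite add0r; set d := m.+1%:R^-1 => de.
  have d0 : 0 < d by rewrite invr_gt0.
  have rat_below (x : R) : exists q : rat, ratr q <= x < ratr q + d.
    have [|q] := @rat_in_itvoo R (x - d) x; first by rewrite gtrBl.
    by rewrite in_itv /= => /andP[l r]; exists q; apply/andP; split; lra.
  have [q1 h1] := rat_below (complex.Re (\z z)); have [q2 h2] := rat_below (complex.Im (\z z)).
  exists m => //; exists q1 => //; exists q2 => //; split; first by split.
  move=> w [/= /andP[a1 a2] /andP[a3 a4]]; rewrite -/d in a2 a4; apply: eV; rewrite -ball_normE /ball_ /= eE.
  move: h1 h2 => /andP[? ?] /andP[? ?].
  rewrite normc_def ltcR -[ltRHS](@ger0_norm R) ?ltW // -sqrtr_sqr ltr_sqrt ?exprn_gt0 //.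
  rewrite !cReD !cImD !cReN !cImN.
  suff [] : `|complex.Re (\z z) - complex.Re (\z w)| < d /\ `|complex.Im (\z z) - complex.Im (\z w)| < d.
    move=> a b; have : d < complex.Re e / 2 by [].
    rewrite -(real_normK (num_real (complex.Re _ - _))) -(real_normK (num_real (complex.Im _ - _))).
    have := normr_ge0 (complex.Re (\z z) - complex.Re (\z w)).
    have := normr_ge0 (complex.Im (\z z) - complex.Im (\z w)).
    by nra.
  by clearbody d; split; rewrite ltr_norml; apply/andP; split; lra.
pose TG := g_sigma_algebraType G.
apply: (@bigcupT_measurable _ TG) => m; apply: (@bigcupT_measurable_rat _ TG) => q1.
apply: (@bigcupT_measurable_rat _ TG) => q2.
have [bV|bV] := pselect (box q1 q2 m `<=` set_val @^-1` V).
  rewrite (_ : [set z | _] = box q1 q2 m) //.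
  by apply/seteqP; split=> z //= [].
rewrite (_ : [set z | _] = set0) //.
by apply/seteqP; split=> z //= [].
Qed.

Lemma indicator_multiplier (A : set T) f : measurable A -> Z f ->
  Z (fun z => (\1_A z)%:C%C *: f z).
Proof.
by move=> mA; have [_ _] : multiplier (\1_A) :=
  smallest_sub multiplier_sigma_algebra open_multiplier mA; apply.
Qed.

End reducing_subspace.

End bilateral_shift.

(** * Uniqueness of Fourier coefficients *)

Section fourier_uniqueness.
Variables (R : realType) (K : completeNormedModType R[i]).
Variable ip : {dot K for Num.conj}.
Hypothesis ip_norm : forall x : K, ip x x = `|x| ^+ 2.
Hypothesis K_separable : separable K.
Local Notation C := R[i].
Local Notation T := (circle R).
Local Notation mu := (Defs.arc R).
Local Notation L2 := (@l2 R K).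
Local Notation B := (l2ip ip).
Local Notation sq := (sqnorm (l2ip ip)).
Local Notation Int f := (Rintegral mu setT f).
Local Notation "\z z" := (val z : C) (at level 8, z at level 8, format "\z z").
Implicit Types f g h : T -> K.

Let SI := semi_inner_ip ip_norm.
Let BL := semi_inner_l2 ip_norm K_separable.
Let LL := linear_l2 ip_norm K_separable.

Lemma ae_ortho_indicator f g : L2 f -> L2 g ->
  (forall A : set T, measurable A ->
    complex.Re (B (fun z => (\1_A z)%:C%C *: f z) g) = 0) ->
  {ae mu, forall z, complex.Re (ip (f z) (g z)) = 0}.
Proof.
move=> Lf Lg h0; have ifg := ip_int ip_norm K_separable Lf Lg.
have : ae_eq mu setT (EFin \o (fun z => complex.Re (ip (f z) (g z)))) (cst 0%E).
  apply: integral_ae_eq => // A _ mA; rewrite integral0 integral_mkcond.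
  have LA : L2 (fun z => (\1_A z)%:C%C *: f z).
    apply: (l2_mul ip_norm K_separable (c := 1)) => //.
      exact: measurable_indic.
    by move=> z; rewrite indicE /abs2 /=; case: (z \in A); rewrite ?expr1n expr0n ?addr0 ?expr0n.
  have := integrable_fin_num measurableT (ip_int ip_norm K_separable LA Lg).
  move=> /fineK; rewrite -[fine _]/(complex.Re (B (fun z => (\1_A z)%:C%C *: f z) g)) h0 // => h.
  rewrite [RHS]h; apply: eq_integral => z _; rewrite patchE /= indicE.
  case: (z \in A); first by rewrite scale1r.
  by rewrite scale0r (si0l SI).
by apply: filterS => z /(_ Logic.I) [].
Qed.

(** If [f] is orthogonal to all [z^n E], then so is its restriction to any Borel
    set, so the scalar function [<f(z), E(z)>] has zero integral over each. *)
Lemma ae_ortho_zpow f E : L2 f -> L2 E -> (forall n, B f (zpow n E) = 0) ->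
  {ae mu, forall z, ip (f z) (E z) = 0}.
Proof.
move=> Lf LE fE; pose X := range (fun n => zpow n E).
have XL : X `<=` L2 by move=> _ [n _ <-]; exact: (l2_zpow ip_norm).
pose Z := perp L2 B X.
have LZ : linear_set Z by exact: (linear_perp BL).
have cZ : clos L2 B Z `<=` Z by exact: (closed_perp BL).
have Zz m g : Z g -> Z (zpow m g).
  move=> [Lg gX]; split; first exact: (l2_zpow ip_norm).
  move=> _ [n _ <-]; rewrite (zpow_adjoint ip_norm) zpowD.
  by apply: gX; exists (- m + n).
have Zf : Z f by split=> // _ [n _ <-].
have ZA (A : set T) : measurable A -> B (fun z => (\1_A z)%:C%C *: f z) E = 0.
  move=> mA; have [_] : Z (fun z => (\1_A z)%:C%C *: f z).
    apply: (indicator_multiplier ip_norm K_separable LZ _ cZ) => //.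
    - by move=> g [].
    - by move=> g; exact: Zz.
    - by move=> g; exact: Zz.
  by apply; exists 0 => //; rewrite zpow0.
have re0 : {ae mu, forall z, complex.Re (ip (f z) (E z)) = 0}.
  by apply: ae_ortho_indicator => // A mA; rewrite ZA.
have im0 : {ae mu, forall z, complex.Re (ip (f z) (('i%C *: E) z)) = 0}.
  apply: ae_ortho_indicator => //; first exact: (linear_setZ _ LL).
  move=> A mA; rewrite (siZr BL) ?ZA ?mulr0 //.
  apply: (l2_mul ip_norm K_separable (c := 1)) => //.
    exact: measurable_indic.
  by move=> z; rewrite indicE /abs2 /=; case: (z \in A); rewrite ?expr1n expr0n ?addr0 ?expr0n.
apply: filterS2 re0 im0 => z r i; apply: complex_ext => //.
by rewrite (Im_ip ip_norm) i.
Qed.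

Lemma closure_ortho (A : set K) x : closure A x -> (forall a, A a -> ip x a = 0) -> x = 0.
Proof.
move=> /closure_rnormP clA Aa.
suff xx : ip x x = 0.
  apply/rnorm_eq0/eqP; rewrite -sqrf_eq0 -(sq_ip ip_norm).
  by rewrite -[X in X == 0]/(complex.Re (ip x x)) xx.
apply: (clos_ortho SI (A := A)) => // [|a /Aa xa].
  split=> // e e0; have s0 : 0 < Num.sqrt e by rewrite sqrtr_gt0.
  have [y Ay xy] := clA _ s0; exists y => //; rewrite (sq_ip ip_norm).
  by rewrite -[ltRHS](@sqr_sqrtr _ e) ?ltW // ltrXn2r // rnorm_ge0.
by rewrite (siC SI (f := x)) // xa rmorph0.
Qed.

(** Testing against a dense sequence keeps the exceptional set null. *)
Lemma fourier_unique (d : nat -> K) f : (forall x e, 0 < e -> exists n, rnorm (x - d n) < e) ->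
  L2 f -> (forall n m, B f (zpow n (fun=> d m)) = 0) -> sq f = 0.
Proof.
move=> dd Lf fd; apply: (sq_null ip_norm); first exact: l2_borel Lf.
have : {ae mu, forall z, forall m, ip (f z) (d m) = 0}.
  by apply/ae_foralln => m; apply: (ae_ortho_zpow Lf) => //; exact: l2_cst.
apply: filterS => z fz; apply: (@closure_ortho (range d)); last by move=> _ [m _ <-].
by apply/closure_rnormP => e e0; have [m] := dd (f z) e e0; exists (d m).
Qed.

Lemma countable_l2_orthonormal (J : choiceType) (u : J -> T -> K) :
  (forall j, L2 (u j)) -> orthonormal_for B u -> countable [set: J].
Proof.
move=> Lu ON; have [d dd] := dense_seq K_separable.
have Lq p : L2 (zpow p.1 (fun=> d p.2)) by apply: (l2_zpow ip_norm) => //; exact: l2_cst.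
pose q n := if unpickle n is Some p then zpow p.1 (fun=> d p.2) : T -> K else 0.
apply: (countable_orthonormal BL Lu ON (q := q)).
  by move=> n; rewrite /q; case: (unpickle n) => [p|]; [exact: Lq|exact: LL.1].
move=> f Lf fq; apply: (fourier_unique dd) => // n m.
by have := fq (pickle (n, m)); rewrite /q pickleK.
Qed.

Lemma expiX t n : (val (expi t) : C) ^+ n = (cos (n%:R * t) +i* sin (n%:R * t))%C.
Proof.
elim: n => [|n ih]; first by rewrite mul0r cos0 sin0 expr0.
rewrite exprS ih -natr1 addrC mulrDl mul1r cosD sinD.
by apply: complex_ext => /=; ring.
Qed.

Lemma Rintegral_arc (p : T -> R) : measurable_fun setT p -> (forall z, 0 <= p z) ->
  (\int[mu]_z (p z)%:E = (2 * pi)^-1%:E *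
    \int[lebesgue_measure]_(t in `[0%R, (2 * pi)%R]) (p (expi t))%:E)%E.
Proof.
move=> mp p0; have mpE : measurable_fun setT (EFin \o p) by exact/measurable_EFinP.
rewrite ge0_integral_pushforward //; last by move=> z _; rewrite lee_fin.
rewrite preimage_setT integral_uniform ?subr0 //.
  exact: (measurableT_comp mpE (@measurable_expi R)).
by move=> t; rewrite lee_fin.
Qed.

(** Adding 1 makes the integrand nonnegative, so that it can be transported to
    the angle coordinate, where [F] is a primitive of it. *)
Lemma mean_primitive (p : T -> R) (F q : R -> R) : measurable_fun setT p ->
  (forall z, 0 <= 1 + p z) -> (forall t, p (expi t) = q t) -> continuous q ->
  (forall t : R, is_derive t 1 F (1 + q t)) -> F (2 * pi) - F 0 = 2 * pi ->
  mu.-integrable setT (EFin \o p) -> Int p = 0.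
Proof.
move=> mp p0 pq cq dF F2 ip_.
have dFt t : derivable F t 1 by case: (dF t).
have cF : continuous F by move=> t; apply/differentiable_continuous/derivable1_diffP.
have : (\int[mu]_z (1 + p z)%:E = 1)%E.
  rewrite Rintegral_arc //; last by apply: measurable_funD.
  under eq_integral do rewrite pq.
  rewrite (@continuous_FTC2 _ _ F).
  - by rewrite -EFinB F2 -EFinM mulVf // gt_eqF // twopi_gt0.
  - exact: twopi_gt0.
  - apply: continuous_subspaceT => t; apply: cvgD; [exact: cvg_cst|exact: cq].
  - split=> [t _//||]; first by apply: cvg_at_right_filter; exact: cF.
    by apply: cvg_at_left_filter; exact: cF.
  - by move=> t _; rewrite derive1E; case: (dF t).
move=> h; have : Int (fun z => 1 * cst 1 z + 1 * p z) = 1.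
  by rewrite /Rintegral; under eq_integral do rewrite !mul1r; rewrite h.
rewrite Rintegral_lin //; last exact: finite_measure_integrable_cst.
rewrite Rintegral_cst // [X in fine X](_ : _ = 1%E) /=; last exact: probability_setT.
lra.
Qed.

Lemma bounded_int (p : T -> R) (c : R) : measurable_fun setT p ->
  (forall z, `|p z| <= c) -> mu.-integrable setT (EFin \o p).
Proof.
move=> mp pc; apply: (@integrable_le _ _ _ _ _ (fun=> c)) => //.
exact: finite_measure_integrable_cst.
Qed.

Lemma zn_le1 (z : T) n : `|complex.Re (\z z ^ n)| <= 1 /\ `|complex.Im (\z z ^ n)| <= 1.
Proof.
have := abs2_zn z n; rewrite /abs2 => e; split; rewrite -(@ler_pXn2r _ 2) ?nnegrE //.
  by rewrite real_normK ?num_real // expr1n -e lerDl sqr_ge0.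
by rewrite real_normK ?num_real // expr1n -e lerDr sqr_ge0.
Qed.

Lemma is_derive_scale (g dg : R -> R) (a t : R) : (forall x : R, is_derive x 1 g (dg x)) ->
  is_derive t 1 (fun s : R => g (a * s)) (dg (a * t) * a).
Proof.
move=> hg.
have hl : is_derive t (1 : R) (fun s : R => a * s) a.
  have h := is_deriveZ a (is_derive_id t (1 : R)).
  by apply: (is_derive_eq h); rewrite -[_ *: _]/(_ * _) mulr1.
have dg1 x : derivable g x 1 by case: (hg x).
have dl1 : derivable (fun s : R => a * s) t 1 by case: hl.
split.
  apply/derivable1_diffP; apply: (@differentiable_comp _ _ _ _ (fun s : R => a * s) g).
    exact/derivable1_diffP.
  exact/derivable1_diffP.
rewrite -derive1E (derive1_comp dl1 (dg1 _)) !derive1E.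
by case: (hg (a * t)) => _ ->; case: hl => _ ->.
Qed.

Lemma mean_zn (n : int) : n != 0 ->
  Int (fun z => complex.Re (\z z ^ n)) = 0 /\ Int (fun z => complex.Im (\z z ^ n)) = 0.
Proof.
wlog [m ->] : n / exists m : nat, n = m.+1 => [wl|_].
  case: n => [[//|n]|n] n0; first by apply: wl => //; exists n.
  have [||r i] := wl n.+1; [by exists n|by []|].
  split.
    by rewrite -[RHS]r; apply: eq_Rintegral => z _; rewrite NegzE zN cReC.
  have -> : (fun z : T => complex.Im (\z z ^ Negz n)) =
      (fun z => -1 * complex.Im (\z z ^ n.+1)).
    by apply/funext => z; rewrite NegzE zN cImC mulN1r.
  rewrite RintegralZl ?i ?mulr0 //.
  by apply: (@bounded_int _ 1) => [|z]; [case: (measurable_zn R n.+1)|case: (zn_le1 z n.+1)].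
pose N : R := m.+1%:R; have N0 : N != 0 by rewrite pnatr_eq0.
have [mr mi] := measurable_zn R m.+1.
have e2pi : cos (N * (2 * pi)) = 1 /\ sin (N * (2 * pi)) = 0 :> R.
  have := expiX (2 * pi) m.+1; have := expiX (2 * pi) 1; rewrite mul1r expr1 => ->.
  rewrite [2 * pi]mulr_natl cos2pi sin2pi expr1n.
  by move=> [<- <-].
split.
- apply: (@mean_primitive _ (fun t => t + N^-1 * sin (N * t)) (fun t => cos (N * t))) => //.
  + by move=> z; have [+ _] := zn_le1 z m.+1; rewrite ler_norml => /andP[? ?]; lra.
  + by move=> t; rewrite -exprnP expiX.
  + move=> t; apply: (@continuous_comp _ _ _ (fun s => N * s) cos); last exact: continuous_cos.
    by apply: cvgM; [exact: cvg_cst|exact: cvg_id].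
  + move=> t; have h := is_deriveD (is_derive_id t 1)
      (is_deriveZ N^-1 (is_derive_scale N t (@is_derive_sin R))).
    by apply: (is_derive_eq h); rewrite -[_ *: _]/(_ * _); field.
  + by rewrite mulr0 sin0 mulr0 addr0 (proj2 e2pi) mulr0 addr0 subr0.
  + by apply: (@bounded_int _ 1) => // z; case: (zn_le1 z m.+1).
- apply: (@mean_primitive _ (fun t => t - N^-1 * cos (N * t)) (fun t => sin (N * t))) => //.
  + by move=> z; have [_ +] := zn_le1 z m.+1; rewrite ler_norml => /andP[? ?]; lra.
  + by move=> t; rewrite -exprnP expiX.
  + move=> t; apply: (@continuous_comp _ _ _ (fun s => N * s) sin); last exact: continuous_sin.
    by apply: cvgM; [exact: cvg_cst|exact: cvg_id].
  + move=> t; have h := is_deriveB (is_derive_id t 1)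
      (is_deriveZ N^-1 (is_derive_scale N t (@is_derive_cos R))).
    by apply: (is_derive_eq h); rewrite -[_ *: _]/(_ * _); field.
  + by rewrite mulr0 cos0 (proj1 e2pi) !mulr1 sub0r opprK subrK.
  + by apply: (@bounded_int _ 1) => // z; case: (zn_le1 z m.+1).
Qed.

Lemma ortho_cst_zpow (n : int) (c k : K) : n != 0 -> B (fun=> c) (zpow n (fun=> k)) = 0.
Proof.
move=> n0; have [r i] := mean_zn n0; have [mr mi] := measurable_zn R n.
have ir : mu.-integrable setT (EFin \o (fun z : T => complex.Re (\z z ^ n))).
  by apply: (@bounded_int _ 1) => // z; case: (zn_le1 z n).
have ii : mu.-integrable setT (EFin \o (fun z : T => complex.Im (\z z ^ n))).
  by apply: (@bounded_int _ 1) => // z; case: (zn_le1 z n).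
have E z : ip c (zpow n (fun=> k) z) = (\z z ^ n)^* * ip c k by rewrite /zpow (siZr SI).
apply: complex_ext => /=.
  have -> : (fun z : T => complex.Re (ip c (zpow n (fun=> k) z))) =
      (fun z => complex.Re (ip c k) * complex.Re (\z z ^ n) +
                complex.Im (ip c k) * complex.Im (\z z ^ n)).
    by apply/funext => z; rewrite E !ReImE; ring.
  by rewrite Rintegral_lin // r i !mulr0 addr0.
have -> : (fun z : T => complex.Im (ip c (zpow n (fun=> k) z))) =
    (fun z => complex.Im (ip c k) * complex.Re (\z z ^ n) +
              (- complex.Re (ip c k)) * complex.Im (\z z ^ n)).
  by apply/funext => z; rewrite E !ReImE; ring.
by rewrite Rintegral_lin // r i !mulr0 addr0.
Qed.

Lemma l2ip_cst (c k : K) : B (fun=> c) (fun=> k) = ip c k.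
Proof.
apply: complex_ext => /=; rewrite Rintegral_cst //;
  rewrite [X in fine X](_ : _ = 1%E) ?mulr1 //; exact: probability_setT.
Qed.

End fourier_uniqueness.

(** * Hardy space and backward shift *)

Section hardy_space.
Variables (R : realType) (K : completeNormedModType R[i]).
Variable ip : {dot K for Num.conj}.
Hypothesis ip_norm : forall x : K, ip x x = `|x| ^+ 2.
Hypothesis K_separable : separable K.
Local Notation C := R[i].
Local Notation T := (circle R).
Local Notation L2 := (@l2 R K).
Local Notation B := (l2ip ip).
Local Notation sq := (sqnorm (l2ip ip)).
Local Notation H2 := (hardy ip).
Local Notation "\z z" := (val z : C) (at level 8, z at level 8, format "\z z").
Implicit Types f g h : T -> K.

Let SI := semi_inner_ip ip_norm.
Let BL := semi_inner_l2 ip_norm K_separable.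
Let LL := linear_l2 ip_norm K_separable.
Let Lz n f : L2 f -> L2 (zpow n f) := l2_zpow ip_norm K_separable n (f := f).
Let Lk (k : K) : L2 (fun=> k) := l2_cst k.

Lemma sq_cst (k : K) : sq (fun=> k) = rnorm k ^+ 2.
Proof. by rewrite -(sq_ip ip_norm) /sqnorm (l2ip_cst ip). Qed.

(** The weak integral that defines the coefficient exists by the Riesz
    representation of [k |-> <f, z^n k>] on [K]. *)
Lemma fourier_coefP f n k : L2 f ->
  ip (fourier_coef ip f n) k = B f (zpow n (fun=> k)).
Proof.
move=> Lf.
pose P c := forall k, ip c k = cintegral (fun z : T => \z z ^ (- n) * ip (f z) k).
have E k' : cintegral (fun z : T => \z z ^ (- n) * ip (f z) k') = B f (zpow n (fun=> k')).
  by congr cintegral; apply/funext => z; rewrite /zpow (siZr SI) // zN.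
have [|a k1 k2 _ _|k' _|c _ cP] := @riesz _ _ _ _ SI (fun k => B f (zpow n (fun=> k))) (sq f).
- exact: complete_ip.
- have L1 : L2 (zpow n (fun=> k1)) by exact: Lz.
  rewrite (zpow_lin n a (fun=> k1) (fun=> k2)) (siDr BL) ?(siZr BL) //;
    by [exact: Lz|exact: (linear_setZ a LL L1)].
- by rewrite (sq_ip ip_norm) -sq_cst -(sq_zpow ip_norm n (fun=> k')) (rCS BL) //; exact: Lz.
- have : P (fourier_coef ip f n) by apply: (@xgetPex _ 0 P); exists c => k'; rewrite cP // E.
  by move=> /(_ k); rewrite E.
Qed.

Definition negative_modes : set (T -> K) :=
  [set h | exists n : int, exists k : K, n < 0 /\ h = zpow n (fun=> k)].

Lemma negative_modes_l2 : negative_modes `<=` L2.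
Proof. by move=> _ [n [k [_ ->]]]; exact: Lz. Qed.

Lemma hardyP f : H2 f <-> perp L2 B negative_modes f.
Proof.
split=> [[Lf f0]|[Lf f0]]; split=> //.
  by move=> _ [n [k [n0 ->]]]; rewrite -fourier_coefP // f0 // (si0l SI).
move=> n n0; apply: (ip_ext ip_norm) => k.
by rewrite fourier_coefP // (si0l SI) //; apply: f0; exists n, k.
Qed.

Lemma hardy_l2 f : H2 f -> L2 f.
Proof. by case. Qed.
Hint Resolve hardy_l2 : core.

Lemma hardy_neg f n k : H2 f -> n < 0 -> B f (zpow n (fun=> k)) = 0.
Proof. by move=> /hardyP[_ fX] n0; apply: fX; exists n, k. Qed.

Lemma linear_hardy : linear_set H2.
Proof.
have [P0 PL] := linear_perp BL negative_modes_l2.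
split; first exact/hardyP.
by move=> a f g /hardyP Pf /hardyP Pg; apply/hardyP; exact: PL.
Qed.

Lemma hardy_cst (k : K) : H2 (fun=> k).
Proof.
apply/hardyP; split; first exact: Lk.
by move=> _ [n [k' [n0 ->]]]; apply: (ortho_cst_zpow ip_norm); rewrite lt_eqF.
Qed.

Lemma hardy_zpow1 f : H2 f -> H2 (zpow 1 f).
Proof.
move=> Hf; apply/hardyP; split; first by apply: Lz; exact: hardy_l2.
move=> _ [n [k [n0 ->]]]; rewrite (zpow_adjoint ip_norm) zpowD.
by apply: hardy_neg => //; rewrite addrC subr_lt0 (lt_trans n0).
Qed.

Lemma bshiftE f : bshift ip f = zpow (-1) (f - (fun=> fourier_coef ip f 0)).
Proof.
by apply/funext => z; rewrite /zpow /bshift -exprz_inv expr1z.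
Qed.

Lemma l2_rest f : L2 f -> L2 (f - (fun=> fourier_coef ip f 0)).
Proof. by move=> Lf; apply: (linear_setB LL). Qed.

Lemma hardy_bshift f : H2 f -> H2 (bshift ip f).
Proof.
move=> Hf; have Lf := hardy_l2 Hf; rewrite bshiftE; apply/hardyP; split.
  by apply: Lz; exact: l2_rest.
move=> _ [n [k [n0 ->]]]; rewrite (zpow_adjoint ip_norm) zpowD opprK.
rewrite (siBl BL) //; last exact: Lz.
have [->|n1] := eqVneq (1 + n) 0.
  by rewrite -(fourier_coefP 0) // zpow0 (l2ip_cst ip) subrr.
rewrite (ortho_cst_zpow ip_norm) // subr0; apply: hardy_neg => //.
by rewrite lt_neqAle n1 -ltzD1 addrC ltrD2r.
Qed.

(** The constant removed by the backward shift is orthogonal to [z H^2]. *)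
Lemma bshift_adjoint f g : H2 f -> H2 g -> B (bshift ip f) g = B f (zpow 1 g).
Proof.
move=> Hf Hg; have [Lf Lg] := (hardy_l2 Hf, hardy_l2 Hg).
rewrite bshiftE (zpow_adjoint ip_norm) opprK (siBl BL) //; last exact: Lz.
rewrite -[X in _ - X](zpow_unitary ip_norm (-1)) zpowK.
rewrite (siC BL Lg) ?hardy_neg ?rmorph0 ?subr0 //; exact: Lz.
Qed.

Lemma hardy_iter_bshift n f : H2 f -> H2 (iter n (bshift ip) f).
Proof. by move=> Hf; elim: n => //= n ih; exact: hardy_bshift. Qed.

Lemma iter_bshift_adjoint n f g : H2 f -> H2 g ->
  B (iter n (bshift ip) f) g = B f (zpow n g).
Proof.
move=> Hf; elim: n g => [|n ih] g Hg; first by rewrite zpow0.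
rewrite /= bshift_adjoint //; last exact: hardy_iter_bshift.
by rewrite ih ?zpowD 1?addrC //; exact: hardy_zpow1.
Qed.

(** * Model spaces and the Wold decomposition *)

Section model.
Variable N : set (T -> K).
Hypothesis N_model : model_space ip N.
Local Notation M := (ominus ip H2 N).
Local Notation W := (wandering ip M).

Lemma model_hardy f : N f -> H2 f.
Proof. by case: N_model => NH _ _; exact: NH. Qed.

Lemma model_l2 : N `<=` L2.
Proof. by move=> f /model_hardy/hardy_l2. Qed.

Lemma model_linear : linear_set N.
Proof. by case: N_model => _ [N0 NL _] _; split. Qed.

Lemma model_closed : clos L2 B N `<=` N.
Proof.
case: N_model => _ [_ _ cN] _; rewrite -(l2closureE ip_norm K_separable) //.
exact: model_l2.
Qed.

Lemma model_bshift f : N f -> N (bshift ip f).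
Proof. by case: N_model => _ _; apply. Qed.

(** Orthogonal complements are closed, which is why [M] and, below, [W] are put
    in this form. *)
Lemma ominusE : M = perp L2 B (negative_modes `|` N).
Proof.
apply/seteqP; split=> f.
  by move=> [/hardyP[Lf fX] fN]; split=> // h [/fX|/fN].
move=> [Lf fX]; split; last by move=> g Ng; apply: fX; right.
by apply/hardyP; split=> // h Xh; apply: fX; left.
Qed.

Let XL : negative_modes `|` N `<=` L2.
Proof. by move=> h [/negative_modes_l2|/model_l2]. Qed.

Lemma linear_M : linear_set M.
Proof. rewrite ominusE; exact: (linear_perp BL XL). Qed.

Lemma closed_M : clos L2 B M `<=` M.
Proof. rewrite ominusE; exact: (closed_perp BL XL). Qed.

Lemma M_hardy f : M f -> H2 f.
Proof. by case. Qed.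

Lemma M_l2 : M `<=` L2.
Proof. by move=> f /M_hardy/hardy_l2. Qed.

Lemma M_ortho f g : M f -> N g -> B f g = 0.
Proof. by case=> _; apply. Qed.

Lemma N_ortho f g : N f -> M g -> B f g = 0.
Proof.
move=> Nf Mg; rewrite (siC BL (M_l2 Mg) (model_l2 Nf)) M_ortho ?rmorph0 //.
Qed.

Lemma hardy_split f : H2 f -> exists2 g, N g & M (f - g).
Proof.
move=> Hf.
have [g Ng gf] := projection BL (complete_l2 ip_norm K_separable) model_linear
  model_l2 model_closed (hardy_l2 Hf).
exists g => //; split=> //; apply: (linear_setB linear_hardy) => //; exact: model_hardy.
Qed.

Lemma model_perp f : H2 f -> (forall m, M m -> B f m = 0) -> N f.
Proof.
move=> Hf fM; have [g Ng Mfg] := hardy_split Hf.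
have [Lf Lg] := (hardy_l2 Hf, model_l2 Ng).
apply: model_closed; split=> // e e0; exists g => //.
by rewrite /sqnorm (siBl BL Lf Lg (M_l2 Mfg)) (fM _ Mfg) (N_ortho Ng Mfg) subr0.
Qed.

Lemma M_zpow1 f : M f -> M (zpow 1 f).
Proof.
move=> Mf; have Hf := M_hardy Mf; split; first exact: hardy_zpow1.
move=> g Ng; have Hg := model_hardy Ng.
have Lzf : L2 (zpow 1 f) by exact: Lz (M_l2 Mf).
rewrite (siC BL (model_l2 Ng) Lzf) -bshift_adjoint //.
by rewrite N_ortho ?rmorph0 //; exact: model_bshift.
Qed.

Lemma M_zpow (n : nat) f : M f -> M (zpow n f).
Proof.
move=> Mf; elim: n => [|n ih]; first by rewrite zpow0.
by rewrite (_ : Posz n.+1 = 1 + n%:Z) // -zpowD; exact: M_zpow1.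
Qed.

Lemma wanderingP f : W f <-> M f /\ forall m, M m -> B f (zpow 1 m) = 0.
Proof.
split=> [[Mf fS]|[Mf fS]]; split=> //.
  by move=> m Mm; rewrite -shiftE; apply: fS; exists m.
by move=> _ [m Mm <-]; rewrite shiftE; exact: fS.
Qed.

Lemma W_M : W `<=` M.
Proof. by move=> f []. Qed.

Lemma wanderingE : W = perp L2 B ((negative_modes `|` N) `|` (zpow 1 @` M)).
Proof.
apply/seteqP; split=> f.
  move=> /wanderingP[]; rewrite {1}ominusE => -[Lf fX] fS; split=> // h [/fX//|[m Mm <-]].
  exact: fS.
move=> [Lf fX]; apply/wanderingP; split; last by move=> m Mm; apply: fX; right; exists m.
by rewrite ominusE; split=> // h Xh; apply: fX; left.
Qed.

Let WXL : (negative_modes `|` N) `|` (zpow 1 @` M) `<=` L2.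
Proof. by move=> h [/XL//|[m Mm <-]]; apply: Lz; exact: M_l2. Qed.

Lemma linear_W : linear_set W.
Proof. rewrite wanderingE; exact: (linear_perp BL WXL). Qed.

Lemma closed_W : clos L2 B W `<=` W.
Proof. rewrite wanderingE; exact: (closed_perp BL WXL). Qed.

Lemma basis_exists : exists (I : choiceType) (E : I -> T -> K), orthonormal_basis ip E W.
Proof.
have WL : W `<=` L2 by move=> f /W_M/M_l2.
have [I [E [EW EON WE]]] := orthonormal_basis_exists BL (complete_l2 ip_norm K_separable)
  linear_W WL closed_W.
exists I, E; split=> //; rewrite (l2closureE ip_norm K_separable) //.
by apply: (lspan_sub LL) => _ [i _ <-]; apply: WL; apply: EW; exists i.
Qed.

Section wold.
Variables (I : choiceType) (E : I -> T -> K).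
Hypothesis E_basis : orthonormal_basis ip E W.

Lemma basis_W j : W (E j).
Proof. by case: E_basis => EW _ _; apply: EW; exists j. Qed.

Lemma basis_M j : M (E j).
Proof. exact: W_M (basis_W j). Qed.

Lemma basis_l2 j : L2 (E j).
Proof. exact: M_l2 (basis_M j). Qed.

Lemma basis_span : W `<=` clos L2 B (lspan (range E)).
Proof.
case: E_basis => _ _; rewrite (l2closureE ip_norm K_separable) //.
by apply: (lspan_sub LL) => _ [i _ <-]; exact: basis_l2.
Qed.

Definition mode (p : I * int) : T -> K := zpow p.2 (E p.1).

Lemma mode_l2 p : L2 (mode p).
Proof. exact: Lz (basis_l2 _). Qed.

Lemma mode_M j (n : nat) : M (mode (j, n%:Z)).
Proof. exact: M_zpow (basis_M j). Qed.

(** Different powers are orthogonal because [z^n E_i] lies in [z M] for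
    [n > 0], while [E_j] is orthogonal to [z M]. *)
Lemma mode_orthonormal : orthonormal_for B mode.
Proof.
case: E_basis => _ EON _.
have pos i j (k : nat) : B (E j) (zpow k.+1 (E i)) = 0.
  have /wanderingP[_ ES] := basis_W j.
  by rewrite (_ : Posz k.+1 = 1 + k%:Z) // -zpowD ES //; exact: mode_M.
move=> [i n] [j m]; rewrite /mode /= (zpow_adjoint ip_norm) zpowD xpair_eqE.
have [->|nm] := eqVneq n m; first by rewrite addNr zpow0 EON andbT.
rewrite andbF /=.
case e: (- n + m) => [[|k]|k].
- by move: nm; rewrite eq_sym -subr_eq0 addrC e.
- exact: pos.
- rewrite NegzE -[X in X = _](zpow_unitary ip_norm k.+1) zpowD subrr zpow0.
  by rewrite (siC BL (basis_l2 j)) ?pos ?rmorph0 //; exact: Lz (basis_l2 i).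
Qed.

Definition positive_mode (p : I * nat) := mode (p.1, p.2%:Z).

Lemma positive_mode_l2 p : L2 (positive_mode p).
Proof. exact: mode_l2. Qed.

Lemma positive_mode_orthonormal : orthonormal_for B positive_mode.
Proof.
by move=> [i n] [j m]; rewrite /positive_mode mode_orthonormal !xpair_eqE.
Qed.

(** A vector of [M] orthogonal to [W] is [z f1] with [f1] in [M]: indeed
    [P_{zM} f = z P_M (zbar f)]. *)
Lemma M_descent f : M f -> (forall j, B f (E j) = 0) ->
  exists2 f1, M f1 & sq (f - zpow 1 f1) = 0.
Proof.
move=> Mf fE; have Hf := M_hardy Mf; have Lf := M_l2 Mf.
have [g Ng Mf1] := hardy_split (hardy_bshift Hf).
set f1 := bshift ip f - g in Mf1; exists f1 => //.
have [Lf1 Lg] := (M_l2 Mf1, model_l2 Ng).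
set r := f - zpow 1 f1.
have Mr : M r by apply: (linear_setB linear_M) => //; exact: M_zpow1.
have Lr := M_l2 Mr.
have rS m : M m -> B r (zpow 1 m) = 0.
  move=> Mm; have Hm := M_hardy Mm; have Lm := M_l2 Mm.
  rewrite (siBl BL Lf (Lz 1 Lf1) (Lz 1 Lm)) (zpow_unitary ip_norm).
  rewrite -bshift_adjoint // -(siBl BL) //; last exact: hardy_l2 (hardy_bshift Hf).
  by rewrite /f1 opprB addrCA subrr addr0 N_ortho.
have Wr : W r by apply/wanderingP.
have rf : B r f = 0.
  apply: (clos_ortho BL _ Lf (basis_span Wr)) => [|h].
    by apply: (lspan_sub LL) => _ [i _ <-]; exact: basis_l2.
  have : lspan (range E) `<=` perp L2 B [set f].
    apply: lspan_sub; first by apply: (linear_perp BL) => _ ->.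
    move=> _ [j _ <-]; split; first exact: basis_l2.
    by move=> _ ->; rewrite (siC BL Lf (basis_l2 j)) fE rmorph0.
  by move=> sub /sub[_]; apply.
by rewrite /sqnorm {2}/r (siBr BL Lf (Lz 1 Lf1) Lr) rf rS // subr0.
Qed.

(** Each descent step [f = z f1] lowers the index of the Fourier coefficients by
    one; as Hardy functions have none of negative index, an element of [M]
    orthogonal to all [z^n E_j] has none at all. *)
Lemma wold : M `<=` clos L2 B (lspan (range positive_mode)).
Proof.
have posM p : M (positive_mode p) by exact: mode_M.
have cL := complete_l2 ip_norm K_separable.
apply: (total_clos BL positive_mode_l2 cL linear_M M_l2 closed_M posM) => f Mf fE.
have descent h : M h -> (forall p, B h (positive_mode p) = 0) ->
    exists h1, [/\ M h1, forall p, B h1 (positive_mode p) = 0 &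
      forall g, L2 g -> B h g = B h1 (zpow (-1) g)].
  move=> Mh hE; have [|h1 Mh1 h0] := @M_descent h Mh.
    by move=> j; have := hE (j, 0%N); rewrite /positive_mode /mode zpow0.
  have [Lh Lh1] := (M_l2 Mh, M_l2 Mh1).
  have hg g : L2 g -> B h g = B h1 (zpow (-1) g).
    move=> Lg; apply/eqP; rewrite -(zpow_adjoint ip_norm) -subr_eq0.
    rewrite -(siBl BL) //; last exact: Lz.
    by rewrite (null_ortho BL) //; apply: (linear_setB LL) => //; exact: Lz.
  exists h1; split=> // -[j n]; rewrite -(hE (j, n.+1)) /positive_mode /mode /= hg.
    by rewrite zpowD (_ : -1 + _ = n%:Z) // -[n.+1]add1n PoszD addKr.
  exact: Lz (basis_l2 j).
have nonneg (n : nat) h k : M h -> (forall p, B h (positive_mode p) = 0) ->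
    B h (zpow n (fun=> k)) = 0.
  elim: n h => [|n ih] h Mh hE; have [h1 [Mh1 h1E hg]] := descent _ Mh hE.
    by rewrite hg ?zpowD; [apply: hardy_neg => //; exact: M_hardy|exact: Lz].
  rewrite hg ?zpowD; last exact: Lz.
  by rewrite (_ : -1 + _ = n%:Z) ?ih // -[n.+1]add1n PoszD addKr.
have [d dd] := dense_seq K_separable.
apply: (fourier_unique ip_norm K_separable dd (M_l2 Mf)) => -[n|n] m.
  exact: nonneg.
by apply: hardy_neg => //; exact: M_hardy.
Qed.

(** * Strong stability and the Parseval frame property *)

Definition frame (p : I * nat) : T -> K := iter p.2 (bshift ip) (bshift ip (E p.1)).

Lemma frameE p : frame p = iter p.2.+1 (bshift ip) (E p.1).
Proof. by rewrite iterSr. Qed.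

Lemma frame_N p : N (frame p).
Proof.
rewrite /frame; elim: p.2 => [|n ih] /=; last exact: model_bshift.
have HE := M_hardy (basis_M p.1).
apply: model_perp => [|m Mm]; first exact: hardy_bshift.
rewrite bshift_adjoint //; last exact: M_hardy.
by have /wanderingP[_ ->] := basis_W p.1.
Qed.

(** [<f, S^*^(n+1) E_j> = <S^(n+1) f, E_j> = <f, z^-(n+1) E_j>]. *)
Lemma frame_coef f p : N f ->
  abs2 (B f (frame p)) = abs2 (B f (mode (p.1, Negz p.2))).
Proof.
move=> Nf; have Lf := model_l2 Nf.
rewrite (siC BL (model_l2 (frame_N p)) Lf) abs2C frameE.
rewrite iter_bshift_adjoint; [|exact: M_hardy (basis_M _)|exact: model_hardy].
by rewrite /mode /= NegzE -(zpow_adjoint ip_norm) (siC BL (basis_l2 _) (Lz _ Lf)) abs2C.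
Qed.

Lemma projP f : L2 f -> N (Defs.proj ip N f) /\ forall h, N h -> B (f - Defs.proj ip N f) h = 0.
Proof.
move=> Lf.
have [g Ng fg] := projection BL (complete_l2 ip_norm K_separable) model_linear
  model_l2 model_closed Lf.
by apply: (@xgetPex _ 0 [set g | N g /\ forall h, N h -> B (f - g) h = 0]); exists g.
Qed.

Lemma iter_compression n f : N f -> N (iter n (compression ip N) f) /\
  M (zpow n f - iter n (compression ip N) f).
Proof.
move=> Nf; elim: n => [|n [Nn Mn]]; first by rewrite zpow0 /= subrr; split=> //; case: linear_M.
set g := iter n _ f in Nn Mn *; have Hg := model_hardy Nn.
have [Np gp] := projP (Lz 1 (model_l2 Nn)).
rewrite [iter _ _ _]/= -/g /compression shiftE; split=> //.
have Mp : M (zpow 1 g - Defs.proj ip N (zpow 1 g)).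
  split=> //; apply: (linear_setB linear_hardy); first exact: hardy_zpow1.
  exact: model_hardy.
have := linear_setD linear_M (M_zpow1 Mn) Mp.
by rewrite zpowB zpowD addrA subrK -[n.+1]add1n PoszD.
Qed.

Local Notation frame2 f := (fun p => (abs2 (B f (frame p)))%:E).

(** What [A_N^n] loses is exactly the first [n] layers of frame coefficients:
    [P_M S^n f] has coefficients [<S^n f, z^k E_j> = <f, z^(k-n) E_j>], which
    vanish for [k >= n]. *)
Lemma compression_loss n f : N f ->
  (sq f - sq (iter n (compression ip N) f))%:E =
  (\esum_(p in [set p : I * nat | (p.2 < n)%N]) frame2 f p)%E.
Proof.
move=> Nf; have Lf := model_l2 Nf; have [Ng Mm] := iter_compression n Nf.
set g := iter n _ f in Ng Mm *; set m := zpow n f - g in Mm.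
have [Lg Lm] := (model_l2 Ng, M_l2 Mm).
have -> : sq f - sq g = sq m.
  rewrite -(sq_zpow ip_norm n f) (_ : zpow n f = m + g); last by rewrite subrK.
  by rewrite (sqD BL Lm Lg) (M_ortho Mm Ng) mulr0 addr0 addrK.
rewrite -((parseval BL positive_mode_l2 positive_mode_orthonormal Lm).2 (wold Mm)).
pose D := [set p : I * nat | (p.2 < n)%N].
(* Layer [k < n] of [P_M S^n f] is layer [n - 1 - k] of the frame. *)
pose e (p : I * nat) : I * nat := (p.1, (n.-1 - p.2)%N).
have coef p : (abs2 (B m (positive_mode p)))%:E =
    (if p \in D then (abs2 (B f (frame (e p))))%:E else 0%E).
  case: p => j k; rewrite (siBl BL (Lz n Lf) Lg (positive_mode_l2 _)).
  rewrite (N_ortho Ng (mode_M _ _)) subr0 (zpow_adjoint ip_norm) zpowD.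
  case: ifPn => [|]; rewrite ?inE /D /= => kn.
    by rewrite frame_coef // /mode /= NegzE; congr (abs2 (B f (zpow _ _)))%:E; lia.
  move: kn; rewrite notin_setE /= => /negP; rewrite -leqNgt => nk.
  rewrite (_ : - n%:Z + k = (k - n)%N) ?N_ortho //; first by rewrite /abs2 /= expr0n addr0.
    exact: (mode_M j (k - n)).
  by lia.
rewrite (eq_esum (fun p _ => coef p)) -esum_mkcond.
rewrite [RHS](reindex_esum D D e) //; split.
- by move=> p; rewrite /D /= => pn; lia.
- by move=> [i k] [j l]; rewrite !inE /D /= => kn ln [-> kl]; congr (_, _); lia.
- move=> [j k]; rewrite /D /= => kn; exists (j, (n.-1 - k)%N) => /=; first lia.
  by rewrite /e /=; congr (_, _); lia.
Qed.

Definition negative_mode (p : I * nat) := mode (p.1, Negz p.2).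

Lemma negative_mode_l2 p : L2 (negative_mode p).
Proof. exact: mode_l2. Qed.

Lemma negative_mode_orthonormal : orthonormal_for B negative_mode.
Proof.
by move=> [i n] [j m]; rewrite /negative_mode mode_orthonormal !xpair_eqE.
Qed.

Lemma frame_sumE f : N f -> (\esum_(p in setT) frame2 f p)%E =
  (\esum_(p in setT) (abs2 (B f (negative_mode p)))%:E)%E.
Proof. by move=> Nf; apply: eq_esum => p _; rewrite frame_coef. Qed.

Lemma frame_bessel f : N f -> (\esum_(p in setT) frame2 f p <= (sq f)%:E)%E.
Proof.
move=> Nf; rewrite frame_sumE //.
exact: (bessel BL negative_mode_l2 negative_mode_orthonormal (model_l2 Nf)).
Qed.

Lemma l2norm_cvg0 (u : nat -> T -> K) : (forall n, L2 (u n)) ->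
  (fun n => l2norm (u n)) @ \oo --> (0 : R) <->
  forall e : R, 0 < e -> \forall n \near \oo, sq (u n) < e.
Proof.
move=> Lu; have n0 n : 0 <= l2norm (u n) by exact: sqrtr_ge0.
split=> [/cvgrPdist_lt u0 e e0|u0].
  have s0 : 0 < Num.sqrt e by rewrite sqrtr_gt0.
  apply: filterS (u0 _ s0) => n; rewrite sub0r normrN ger0_norm //.
  by rewrite (l2norm_lt ip_norm K_separable) // sqr_sqrtr // ltW.
apply/cvgrPdist_lt => e e0; have e2 : 0 < e ^+ 2 by rewrite exprn_gt0.
apply: filterS (u0 _ e2) => n; rewrite sub0r normrN ger0_norm //.
by rewrite (l2norm_lt ip_norm K_separable).
Qed.

(** By [compression_loss] the squared norm of [A_N^n f] is the part of [|f|^2]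
    not yet accounted for by the first [n] layers of the frame. *)
Lemma stable_parseval f : N f ->
  (fun n => l2norm (iter n (compression ip N) f)) @ \oo --> (0 : R) <->
  (\esum_(p in setT) frame2 f p)%E = (sq f)%:E.
Proof.
move=> Nf; set g := fun n => iter n (compression ip N) f.
have Ng n : N (g n) by case: (iter_compression n Nf).
have loss n : (sq f - sq (g n))%:E = _ := compression_loss n Nf.
apply: (iff_trans (l2norm_cvg0 (fun n => model_l2 (Ng n)))); split=> [g0|sum e e0].
  apply/eqP; rewrite eq_le frame_bessel //=; apply/lee_addgt0Pr => e e0.
  have [n _ /(_ n (leqnn n)) /= gn] := g0 _ e0.
  apply: (@le_trans _ _ ((sq f - sq (g n))%:E + e%:E)%E).
    by rewrite -EFinD lee_fin; lra.
  rewrite leeD2r // loss esum_mkcond; apply: le_esum => p _.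
  by case: ifP => _ //; rewrite lee_fin abs2_ge0.
have : ((sq f - e)%:E < \esum_(p in setT) frame2 f p)%E.
  by rewrite sum lte_fin ltrBlDr ltrDl.
move=> /ereal_sup_gt[_ [F [finF _] <-]] lt.
have [n0 Fn0] : exists n0, F `<=` [set p : I * nat | (p.2 < n0)%N].
  exists (\max_(p <- finmap.enum_fset (fset_set F)) p.2).+1 => p Fp /=.
  rewrite ltnS; apply: (@leq_bigmax_seq _ _ xpredT (fun p : I * nat => p.2)) => //.
  by rewrite in_fset_set // inE.
exists n0 => // n /= n0n.
have : ((sq f - e)%:E < (sq f - sq (g n))%:E)%E.
  apply: lt_le_trans lt _; rewrite loss; apply: esum_ge; exists F => //.
  by split=> // p /Fn0 /= pn; exact: leq_trans pn n0n.
by rewrite lte_fin; lra.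
Qed.

(** * Full range *)

(** The index set [I] is arbitrary, and its countability is what allows the null
    sets attached to the [E_j] to be collected into one. *)
Lemma mode_total : {ae Defs.arc R, forall z, range_space E z = setT} ->
  forall f, L2 f -> (forall p, B f (mode p) = 0) -> sq f = 0.
Proof.
move=> full f Lf fE; apply: (sq_null ip_norm); first exact: l2_borel Lf.
have cI : countable [set: I].
  apply: (countable_l2_orthonormal ip_norm K_separable basis_l2).
  by case: E_basis.
have /countable_injP[c cinj] := cI.
have : {ae Defs.arc R, forall z, forall n j, c j = n -> ip (f z) (E j z) = 0}.
  apply/ae_foralln => n; have [[j cj]|nj] := pselect (exists j, c j = n).
    have := ae_ortho_zpow ip_norm K_separable Lf (basis_l2 j) (fun m => fE (j, m)).
    apply: filterS => z fz i ci; rewrite (cinj i j) ?inE //; first by rewrite ci.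
  by apply: aeW => z j cj; case: nj; exists j.
move: full; apply: filterS2 => z full fz.
apply: (closure_ortho ip_norm (A := lspan (range (fun j => E j z)))).
  by rewrite -/(range_space E z) full.
suff : lspan (range (fun j => E j z)) `<=` [set a | ip (f z) a = 0] by [].
apply: lspan_sub => [|_ [j _ <-]]; last exact: (fz (c j)).
split; first by rewrite /= (si0r SI).
by move=> a x y /= x0 y0; rewrite (siDr SI) // (siZr SI) // x0 y0 mulr0 addr0.
Qed.

(** Elements of [N] are orthogonal to the modes of nonnegative index, so
    Parseval's identity for all modes is the one for the frame. *)
Lemma full_range_parseval : {ae Defs.arc R, forall z, range_space E z = setT} ->
  forall f, N f -> (\esum_(p in setT) frame2 f p)%E = (sq f)%:E.
Proof.
move=> full f Nf; have Lf := model_l2 Nf; rewrite frame_sumE //.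
have fmode : clos L2 B (lspan (range mode)) f.
  apply: (total_clos BL mode_l2 (complete_l2 ip_norm K_separable) LL) => //.
  - by move=> g [].
  - exact: mode_l2.
  - exact: mode_total full.
rewrite -((parseval BL mode_l2 mode_orthonormal Lf).2 fmode).
pose e (p : I * nat) : I * int := (p.1, Negz p.2).
pose D := range e.
have -> : (\esum_(p in setT) (abs2 (B f (mode p)))%:E =
    \esum_(p in D) (abs2 (B f (mode p)))%:E)%E.
  rewrite [RHS]esum_mkcond; apply: eq_esum => -[j [n|n]] _; last first.
    by rewrite mem_set //; exists (j, n).
  rewrite N_ortho //; last exact: mode_M.
  by case: ifP => //; rewrite /abs2 /= expr0n addr0.
rewrite (reindex_esum setT D e) //; split => //.
- by move=> p _; exists p.
- by move=> [i n] [j m] _ _ [-> ->].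
Qed.

(** [N] is reached through the frame and [M] through the Wold decomposition. *)
Lemma hardy_clos_mode :
  (forall f, N f -> (\esum_(p in setT) frame2 f p)%E = (sq f)%:E) ->
  H2 `<=` clos L2 B (lspan (range mode)).
Proof.
move=> par f Hf; have [g Ng Mfg] := hardy_split Hf.
have LS : linear_set (clos L2 B (lspan (range mode))).
  apply: (linear_clos BL); first exact: linear_lspan.
  by apply: (lspan_sub LL) => _ [p _ <-]; exact: mode_l2.
have sub (u : I * nat -> T -> K) : (forall p, exists q, u p = mode q) ->
    clos L2 B (lspan (range u)) `<=` clos L2 B (lspan (range mode)).
  move=> um; apply: clos_mono; apply: lspan_sub; first exact: linear_lspan.
  by move=> _ [p _ <-]; have [q ->] := um p; apply: sub_lspan; exists q.
rewrite -(subrK g f); apply: (linear_setD LS).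
  by apply: (sub positive_mode) (wold Mfg) => p; exists (p.1, p.2%:Z).
apply: (sub negative_mode) => [p|]; first by exists (p.1, Negz p.2).
apply/(parseval BL negative_mode_l2 negative_mode_orthonormal (model_l2 Ng)).
by rewrite -frame_sumE // par.
Qed.

(** Constants are limits of combinations of the [z^n E_j], almost everywhere
    along a fast sequence; pointwise those combinations lie in the span of the
    [E_j z]. *)
Lemma parseval_full_range :
  (forall f, N f -> (\esum_(p in setT) frame2 f p)%E = (sq f)%:E) ->
  {ae Defs.arc R, forall z, range_space E z = setT}.
Proof.
move=> par; have [d dd] := dense_seq K_separable.
have mode_range g z : lspan (range mode) g -> lspan (range (fun j => E j z)) (g z).
  suff : lspan (range mode) `<=` [set g | lspan (range (fun j => E j z)) (g z)] by apply.
  have LS := linear_lspan (range (fun j => E j z)).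
  apply: lspan_sub => [|_ [p _ <-]].
    by split=> [|a u v /= Su Sv]; [exact: LS.1|exact: LS.2].
  by apply: linear_setZ => //; apply: sub_lspan; exists p.1.
have key k : {ae Defs.arc R, forall z, range_space E z k}.
  have [Lk' ck] := hardy_clos_mode par (hardy_cst k).
  have /choice[g gP] : forall n, exists g, lspan (range mode) g /\
      sq ((fun=> k) - g) < (4^-1) ^+ n.
    move=> n; have [|g Sg kg] := ck ((4^-1) ^+ n); last by exists g.
    by rewrite exprn_gt0 // invr_gt0.
  have Lg n : L2 ((fun=> k) - g n).
    apply: (linear_setB LL) => //; have [+ _] := gP n.
    by apply: (lspan_sub LL) => _ [p _ <-]; exact: mode_l2.
  have : {ae Defs.arc R, forall z, cvgn (series (fun n => rnorm (k - g n z)))}.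
    apply: ae_cvg_series.
    - by move=> n; apply: borel_rnorm; exact: l2_borel (Lg n).
    - by move=> n z; exact: rnorm_ge0.
    - by move=> n; exact: l2_int (Lg n).
    - by move=> n; rewrite -(sq_l2 ip_norm ((fun=> k) - g n)) ltW //; case: (gP n).
  apply: filterS => z /cvg_series_cvg_0 /cvgrPdist_lt c0.
  apply/closure_rnormP => e e0; have [n _ /(_ n (leqnn n)) /= kg] := c0 _ e0.
  exists (g n z); first by apply: mode_range; case: (gP n).
  by move: kg; rewrite sub0r normrN ger0_norm // rnorm_ge0.
have : {ae Defs.arc R, forall z, forall m, range_space E z (d m)}.
  by apply/ae_foralln => m; exact: key.
apply: filterS => z Ez; apply/seteqP; split=> // x _.
apply/closure_rnormP => e e0; have e2 : 0 < e / 2 by rewrite divr_gt0.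
have [m xm] := dd x _ e2; have /closure_rnormP/(_ _ e2)[y Sy my] := Ez m.
exists y => //; apply: le_lt_trans (rnorm_triangle (d m) _ _) _.
by rewrite (splitr e) ltrD.
Qed.

Lemma parseval_frameP :
  parseval_frame ip (fun p : I * nat => iter p.2 (bshift ip) (bshift ip (E p.1))) N <->
  forall f, N f -> (\esum_(p in setT) frame2 f p)%E = (sq f)%:E.
Proof.
have E2 f : N f -> (l2norm f ^+ 2)%:E = (sq f)%:E.
  by move=> Nf; rewrite (l2norm_sq ip_norm) sqr_sqrtr // (sq_ge0 BL) //; exact: model_l2.
have E1 f : (\esum_(p in setT) (rnorm (B f (frame p) : C^o) ^+ 2)%:E =
    \esum_(p in setT) frame2 f p)%E.
  by apply: eq_esum => p _; rewrite rnormE2.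
split=> [[_ _ par] f Nf|par].
  by rewrite -E2 // -par // -E1.
split=> [|_ [p _ <-]|f Nf].
- rewrite -setXTT; apply: countableX; last exact: countableP.
  apply: (countable_l2_orthonormal ip_norm K_separable basis_l2).
  by case: E_basis.
- exact: frame_N.
- by rewrite E2 // -par // -E1.
Qed.

End wold.


End model.

End hardy_space.

Theorem theorem5p9 (R : realType) (K : completeNormedModType R[i])
    (ip : {dot K for Num.conj})
    (ip_norm : forall x : K, ip x x = `|x| ^+ 2)
    (K_separable : separable K)
    (N : set (circle R -> K))
    (N_model : model_space ip N) :
  let M := ominus ip (hardy ip) N in
  let i := full_range ip M in
  let ii := strongly_stable N (compression ip N) in
  let iii := forall (I : choiceType) (E : I -> circle R -> K),
      orthonormal_basis ip E (wandering ip M) ->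
      parseval_frame ip
        (fun p : I * nat => iter p.2 (bshift ip) (bshift ip (E p.1))) N in
  (i <-> ii) /\ (ii <-> iii).
Proof.
move=> M i ii iii.
(* Stability does not mention any basis, so a single one is enough to pass
   from it, or to it. *)
have stableP (I : choiceType) (E : I -> circle R -> K) :
    orthonormal_basis ip E (wandering ip M) ->
    ii <-> parseval_frame ip
        (fun p : I * nat => iter p.2 (bshift ip) (bshift ip (E p.1))) N.
  move=> EW; rewrite parseval_frameP //; split=> h f Nf.
    exact/(stable_parseval ip_norm K_separable N_model EW Nf)/h.
  exact/(stable_parseval ip_norm K_separable N_model EW Nf)/h.
have [I0 [E0 EW0]] := basis_exists ip_norm K_separable N_model.
split; split.
- move=> full; apply/(stableP _ _ EW0)/(parseval_frameP ip_norm K_separable N_model EW0).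
  exact: (full_range_parseval ip_norm K_separable N_model EW0 (full _ _ EW0)).
- move=> st I E EW; apply: (parseval_full_range ip_norm K_separable N_model EW).
  exact/(parseval_frameP ip_norm K_separable N_model EW)/(stableP _ _ EW).
- by move=> st I E EW; exact/(stableP _ _ EW).
- by move=> par; exact/(stableP _ _ EW0)/par.
Qed.
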